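(* Let $f_1,\dots,f_n:\mathbb{R}^d\to\mathbb{R}$ be convex, each $f_i$ being $L_i$-smooth with minimizer $x_i$. Let $\alpha_i\in(0,1)$, $T_i(x)=\alpha_ix+(1-\alpha_i)x_i$, $\tilde f(x)=\frac1n\sum_if_i(T_i(x))$, let $x^*$ be a minimizer of $\tilde f$, and $L_\alpha=\frac1n\sum_i\alpha_i^2L_i$. Let $\omega_i\ge0$ and $\beta_i\in(0,\frac{1}{\omega_i+1}]$. Consider DIANA applied to $\tilde f$: given $x^0,h_1^0,\dots,h_n^0$, for $k\ge0$ set $\Delta_i^k=\alpha_i\nabla f_i(T_i(x^k))-h_i^k$, $\hat\Delta_i^k=\mathcal{C}_i^k(\Delta_i^k)$, $h_i^{k+1}=h_i^k+\beta_i\hat\Delta_i^k$, $g^k=\frac1n\sum_i(h_i^k+\hat\Delta_i^k)$, $x^{k+1}=x^k-\gamma g^k$, with $\mathcal{C}_i^k\in\mathbb{B}^d(\omega_i)$ drawn independently across $i,k$. Let $\sigma_0^2=\frac1n\sum_i\omega_i\|h_i^0-\alpha_i\nabla f_i(T_i(x^* ))\|^2$ and $\overline{x}^k=\frac1k\sum_{j=1}^kx^j$. If \[0<\gamma\leq\frac{1}{4\left(L_\alpha+\frac{2\max_i\{L_i\alpha_i^2\omega_i\}}{n}+\frac{4\max_i\{\beta_i\omega_iL_i\alpha_i^2\}}{n\min_i\beta_i}\right)},\] then \[\mathbb{E}[\tilde f(\overline{x}^k)-\tilde f(x^* )]\leq\left(2(\tilde f(x^0)-\tilde f(x^* ))+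\frac{4\gamma}{n\min_i\beta_i}\sigma_0^2+\frac1\gamma\|x^0-x^*\|^2\right)\frac1k.\]
   Context: A (random) operator $\mathcal{C}$ belongs to $\mathbb{B}^d(\omega)$ if $\mathbb{E}[\mathcal{C}(x)] = x$ and $\mathbb{E}\|\mathcal{C}(x)-x\|^2\leq\omega\|x\|^2$ for all $x$. A differentiable $g$ is $L$-smooth if $\|\nabla g(x)-\nabla g(y)\|\leq L\|x-y\|$ for all $x,y$. *)

(* Defs.v *)
From HB Require Import structures.
From mathcomp Require Import all_boot all_order all_algebra.
From mathcomp Require Import all_classical all_reals all_analysis.
Set Implicit Arguments.
Unset Strict Implicit.
Unset Printing Implicit Defensive.
Import Order.TTheory GRing.Theory Num.Theory.
Import numFieldNormedType.Exports.
Local Open Scope classical_set_scope.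
Local Open Scope ring_scope.

Section Defs.
Variable R : realType.
Variable d : nat.

(* Euclidean inner product and norm on R^d = 'rV[R]_d
   (the library's normr on 'rV is the sup norm, so we define the l2 norm). *)
Definition dotv (u v : 'rV[R]_d) : R := \sum_(j < d) u 0 j * v 0 j.
Definition sqnorm (v : 'rV[R]_d) : R := \sum_(j < d) v 0 j ^+ 2.
Definition enorm (v : 'rV[R]_d) : R := Num.sqrt (sqnorm v).

Definition convex_fun (f : 'rV[R]_d -> R) : Prop :=
  forall (x y : 'rV[R]_d) (t : R), 0 <= t <= 1 ->
    f (t *: x + (1 - t) *: y) <= t * f x + (1 - t) * f y.

Definition is_gradient (f : 'rV[R]_d -> R) (g : 'rV[R]_d -> 'rV[R]_d) : Prop :=
  forall x : 'rV[R]_d, differentiable f x /\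
    forall v : 'rV[R]_d, ('d f x : 'rV[R]_d -> R) v = dotv (g x) v.

Definition L_smooth (g : 'rV[R]_d -> 'rV[R]_d) (L : R) : Prop :=
  forall x y : 'rV[R]_d, enorm (g x - g y) <= L * enorm (x - y).

Definition is_minimizer (f : 'rV[R]_d -> R) (x : 'rV[R]_d) : Prop :=
  forall y, f x <= f y.

Definition rv_of_tuple (t : d.-tuple R) : 'rV[R]_d := \row_(j < d) tnth t j.

Definition jointly_measurable (dX : measure_display) (X : measurableType dX)
  (Phi : X -> 'rV[R]_d -> 'rV[R]_d) : Prop :=
  forall j : 'I_d,
    measurable_fun [set: X * d.-tuple R]
      (fun p : X * d.-tuple R => Phi p.1 (rv_of_tuple p.2) 0 j).

Definition in_Bd (dO : measure_display) (O : measurableType dO)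
  (P : probability O R) (C : O -> 'rV[R]_d -> 'rV[R]_d) (omega : R) : Prop :=
  forall x : 'rV[R]_d,
    (forall j : 'I_d, P.-integrable [set: O] (fun w => (C w x 0 j)%:E) /\
       (\int[P]_w (C w x 0 j)%:E = (x 0 j)%:E)%E) /\
    (\int[P]_w (sqnorm (C w x - x))%:E <= (omega * sqnorm x)%:E)%E.

Definition mutually_independent (dO : measure_display) (O : measurableType dO)
  (P : probability O R) (I : eqType) (dX : measure_display) (X : measurableType dX)
  (xi : I -> O -> X) : Prop :=
  forall (s : seq I) (B : I -> set X), uniq s ->
    (forall p, p \in s -> measurable (B p)) ->
    P (\big[setI/setT]_(p <- s) (xi p @^-1` B p)) =
    (\prod_(p <- s) P (xi p @^-1` B p))%E.

Definition diana_step (n : nat) (alpha beta : 'I_n -> R) (gamma : R)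
  (T : 'I_n -> 'rV[R]_d -> 'rV[R]_d) (gf : 'I_n -> 'rV[R]_d -> 'rV[R]_d)
  (C : 'I_n -> 'rV[R]_d -> 'rV[R]_d)
  (st : 'rV[R]_d * ('I_n -> 'rV[R]_d)) : 'rV[R]_d * ('I_n -> 'rV[R]_d) :=
  let x := st.1 in let h := st.2 in
  let Delta := fun i => alpha i *: gf i (T i x) - h i in
  let Dhat := fun i => C i (Delta i) in
  let g := n%:R^-1 *: \sum_(i < n) (h i + Dhat i) in
  (x - gamma *: g, fun i => h i + beta i *: Dhat i).

Fixpoint diana (n : nat) (alpha beta : 'I_n -> R) (gamma : R)
  (T : 'I_n -> 'rV[R]_d -> 'rV[R]_d) (gf : 'I_n -> 'rV[R]_d -> 'rV[R]_d)
  (x0 : 'rV[R]_d) (h0 : 'I_n -> 'rV[R]_d)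
  (C : nat -> 'I_n -> 'rV[R]_d -> 'rV[R]_d) (k : nat)
  : 'rV[R]_d * ('I_n -> 'rV[R]_d) :=
  match k with
  | 0 => (x0, h0)
  | k'.+1 => diana_step alpha beta gamma T gf (C k')
               (diana alpha beta gamma T gf x0 h0 C k')
  end.

End Defs.

(* Main.v *)
(* Write phi_i = f_i o T_i, which is convex and (alpha_i^2 L_i)-smooth, and s_i for its
   gradient; let z be the minimizer.  The Lyapunov function
     V_k = E |x^k - z|^2 + c sum_i omega_i E |h_i^k - s_i(z)|^2,   c = 4 gamma^2 / (n^2 min beta),
   decreases by at least gamma E [f(x^k) - f(z)] at each step.  The compression errors
   D_i = C_i(Delta_i) - Delta_i are pairwise orthogonal in L^2 and orthogonal to the state, so
   they enter V_{k+1} only through E |D_i|^2 <= omega_i E |Delta_i|^2, and what remains is a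
   deterministic inequality.  It uses |s_i(x) - s_i(z)|^2 <= 2 alpha_i^2 L_i B_i, where the
   Bregman divergences B_i of phi_i between x and z average to f(x) - f(z).  Summing over k
   and applying convexity to the mean iterate gives the rate, even without the term
   2 (f(x^0) - f(z)).

   Orthogonality is proved without conditional expectations: everything except xi_i^k is
   measurable for the sigma-algebra generated by the cylinders avoiding (k, i), which is
   independent of xi_i^k, so the joint law is a product and Fubini's theorem integrates the
   compressor out first. *)

Require Import Defs.
From HB Require Import structures.
From mathcomp Require Import all_boot all_order all_algebra.
From mathcomp Require Import all_classical all_reals all_analysis.
From mathcomp Require Import measurable_realfun ring lra.
Import Order.TTheory GRing.Theory Num.Theory.
Import numFieldNormedType.Exports.
Local Open Scope classical_set_scope.
Local Open Scope ring_scope.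

Set Implicit Arguments.
Unset Strict Implicit.
Unset Printing Implicit Defensive.

(** * Euclidean geometry and smooth convex functions *)

Section Euclidean.
Context {R : realType} {d : nat}.
Implicit Types (u v w : 'rV[R]_d) (a : R).

Lemma dotvC u v : dotv u v = dotv v u.
Proof. by apply: eq_bigr => j _; rewrite mulrC. Qed.

Lemma dotvDl u v w : dotv (u + v) w = dotv u w + dotv v w.
Proof. by rewrite -big_split; apply: eq_bigr => j _; rewrite mxE mulrDl. Qed.

Lemma dotvZl a u v : dotv (a *: u) v = a * dotv u v.
Proof. by rewrite mulr_sumr; apply: eq_bigr => j _; rewrite mxE mulrA. Qed.

Lemma dotvNl u v : dotv (- u) v = - dotv u v.
Proof. by rewrite -scaleN1r dotvZl mulN1r. Qed.

Lemma dotvDr u v w : dotv u (v + w) = dotv u v + dotv u w.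
Proof. by rewrite !(dotvC u) dotvDl. Qed.

Lemma dotvZr a u v : dotv u (a *: v) = a * dotv u v.
Proof. by rewrite !(dotvC u) dotvZl. Qed.

Lemma dotvNr u v : dotv u (- v) = - dotv u v.
Proof. by rewrite !(dotvC u) dotvNl. Qed.

Definition dotvE := (dotvDl, dotvDr, dotvNl, dotvNr, dotvZl, dotvZr).

Lemma dotv0l v : dotv 0 v = 0.
Proof. by rewrite -(scale0r v) dotvZl mul0r. Qed.

Lemma dotv_suml I (r : seq I) (Q : pred I) (F : I -> 'rV[R]_d) v :
  dotv (\sum_(i <- r | Q i) F i) v = \sum_(i <- r | Q i) dotv (F i) v.
Proof.
by elim/big_rec2: _ => [|i y x _ <-]; rewrite ?dotv0l ?dotvDl.
Qed.

Lemma dotv_sumr I (r : seq I) (Q : pred I) (F : I -> 'rV[R]_d) v :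
  dotv v (\sum_(i <- r | Q i) F i) = \sum_(i <- r | Q i) dotv v (F i).
Proof. by rewrite dotvC dotv_suml; apply: eq_bigr => i _; rewrite dotvC. Qed.

Lemma sqnormE v : sqnorm v = dotv v v.
Proof. by apply: eq_bigr => j _; rewrite expr2. Qed.

Lemma sqnorm_ge0 v : 0 <= sqnorm v.
Proof. by apply: sumr_ge0 => j _; exact: sqr_ge0. Qed.

Lemma sqnormZ a v : sqnorm (a *: v) = a ^+ 2 * sqnorm v.
Proof. by rewrite !sqnormE !dotvE; ring. Qed.

Lemma sqnormN v : sqnorm (- v) = sqnorm v.
Proof. by rewrite !sqnormE !dotvE opprK. Qed.

Lemma sqnormD u v : sqnorm (u + v) = sqnorm u + 2 * dotv u v + sqnorm v.
Proof. by rewrite !sqnormE !dotvE (dotvC v u); ring. Qed.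

Lemma sqnormB u v : sqnorm (u - v) = sqnorm u - 2 * dotv u v + sqnorm v.
Proof. by rewrite sqnormD sqnormN dotvNr; ring. Qed.

Lemma sqnormD_le u v : sqnorm (u + v) <= 2 * sqnorm u + 2 * sqnorm v.
Proof. by have := sqnorm_ge0 (u - v); rewrite sqnormB sqnormD; lra. Qed.

Lemma normr_dotv_le u v : `|dotv u v| <= sqnorm u + sqnorm v.
Proof.
have := sqnorm_ge0 (u - v); have := sqnorm_ge0 (u + v).
have := sqnorm_ge0 u; have := sqnorm_ge0 v.
by rewrite sqnormB sqnormD ler_norml => *; apply/andP; split; lra.
Qed.

Lemma sqnorm_eq0 v : sqnorm v = 0 -> v = 0.
Proof.
move=> /eqP; rewrite psumr_eq0; last by move=> j _; exact: sqr_ge0.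
move=> /allP v0; apply/rowP => j; rewrite mxE; apply/eqP.
by rewrite -sqrf_eq0; apply: v0; rewrite mem_index_enum.
Qed.

Lemma cauchy_schwarz u v : dotv u v ^+ 2 <= sqnorm u * sqnorm v.
Proof.
have [v0|vN0] := eqVneq (sqnorm v) 0.
  by rewrite (sqnorm_eq0 v0) dotvC dotv0l expr0n/= mulr_ge0 ?sqnorm_ge0.
have v_gt0 : 0 < sqnorm v by rewrite lt0r vN0 sqnorm_ge0.
have := sqnorm_ge0 (sqnorm v *: u - dotv u v *: v).
rewrite sqnormB !sqnormZ !dotvE => h.
have {h} : 0 <= sqnorm v * (sqnorm u * sqnorm v - dotv u v ^+ 2) by lra.
by rewrite pmulr_rge0// subr_ge0.
Qed.

Lemma enorm_ge0 v : 0 <= enorm v. Proof. exact: sqrtr_ge0. Qed.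

Lemma sqr_enorm v : enorm v ^+ 2 = sqnorm v.
Proof. by rewrite sqr_sqrtr ?sqnorm_ge0. Qed.

Lemma normr_dotv_enorm_le u v : `|dotv u v| <= enorm u * enorm v.
Proof.
by rewrite -sqrtrM ?sqnorm_ge0// -sqrtr_sqr ler_wsqrtr// cauchy_schwarz.
Qed.

Lemma enormZ a v : enorm (a *: v) = `|a| * enorm v.
Proof. by rewrite /enorm sqnormZ sqrtrM ?sqr_ge0// sqrtr_sqr. Qed.

Lemma normr_coord_le v j : `|v 0 j| <= enorm v.
Proof.
rewrite -sqrtr_sqr ler_wsqrtr// /sqnorm (bigD1 j)//= lerDl.
by apply: sumr_ge0 => i _; exact: sqr_ge0.
Qed.

(** The topology on row vectors comes from the sup norm, so passing from Lipschitz bounds to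
    continuity needs this comparison. *)
Lemma enorm_le_norm v : enorm v <= Num.sqrt d%:R * `|v|.
Proof.
have vj j : `|v 0 j| <= `|v| by rewrite [leRHS]mx_normrE (le_bigmax _ _ (0, j)).
rewrite -[`|v|]normr_id -sqrtr_sqr -sqrtrM// ler_wsqrtr// /sqnorm.
rewrite mulr_natl -[X in _ *+ X]card_ord -sumr_const; apply: ler_sum => j _.
by rewrite -real_normK ?num_real// ler_sqr ?nnegrE.
Qed.

Lemma L_smooth_sqnorm (g : 'rV[R]_d -> 'rV[R]_d) (L : R) : L_smooth g L ->
  forall x y, sqnorm (g x - g y) <= L ^+ 2 * sqnorm (x - y).
Proof.
move=> gL x y; rewrite -!sqr_enorm -exprMn ler_sqr ?nnegrE ?enorm_ge0//.
exact: le_trans (enorm_ge0 _) (gL x y).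
Qed.

(** The chain rule along a line, which reduces the quadratic bounds to the one-variable mean value
    theorem. *)
Lemma is_derive_line (f : 'rV[R]_d -> R) (g : 'rV[R]_d -> 'rV[R]_d) x v (t : R) :
  is_gradient f g ->
  is_derive t 1 (fun s : R => f (x + s *: v)) (dotv (g (x + t *: v)) v).
Proof.
move=> fg; have [df dfE] := fg (x + t *: v).
have dl : is_diff t (cst x + *:%R ^~ v : R -> 'rV[R]_d) (0 + *:%R ^~ v).
  exact: is_diffD.
have df' : is_diff ((cst x + *:%R ^~ v : R -> 'rV[R]_d) t) f
             ('d f (x + t *: v)) by exact: DiffDef.
have dc := is_diff_comp dl df'.
have /= ft : differentiable (fun s : R => f (x + s *: v)) t by case: dc.
apply: DeriveDef; first exact/derivable1_diffP.
rewrite deriveE// [LHS](_ : _ = (('d f (x + t *: v) \o (0 + *:%R ^~ v)) : R -> R) 1).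
  by rewrite -dfE /= fctE /= add0r scale1r.
by case: dc => _ <-.
Qed.

(** Taking [s] to be 1 or -1 gives the quadratic bounds above and below the tangent from one
    argument. *)
Lemma taylor1_le (f : 'rV[R]_d -> R) (g : 'rV[R]_d -> 'rV[R]_d) (L s : R) :
  is_gradient f g -> L_smooth g L -> `|s| <= 1 ->
  forall x y, s * (f y - f x - dotv (g x) (y - x)) <= L / 2 * sqnorm (y - x).
Proof.
move=> fg gL s1 x y; set v : 'rV[R]_d := y - x.
(* [psi 1 - psi 0] is the left side of the claim minus its right side. For [t >= 0] the derivative
   of [psi] is nonpositive, by Cauchy-Schwarz and the Lipschitz bound. *)
pose psi (t : R) := s * (f (x + t *: v) - t * dotv (g x) v) - L / 2 * t ^+ 2 * sqnorm v.
have scE (a b : R) : a *: b = a * b by [].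
pose dpsi (t : R) := s * (dotv (g (x + t *: v)) v - dotv (g x) v) - L * t * sqnorm v.
have dpsiP (t : R) : is_derive t 1 psi (dpsi t).
  have df := is_derive_line x v t fg.
  have -> : psi = s \*: ((fun r : R => f (x + r *: v)) - dotv (g x) v \*: id)
      - (L / 2 * sqnorm v) \*: (id ^+ 2).
    by apply/funext => r; rewrite /psi !fctE/= !scE; ring.
  apply: is_derive_eq.
  by rewrite /dpsi !scE/=; field.
have [|c c01] := @MVT R psi dpsi 0 1 ltr01 (fun t _ => dpsiP t).
  apply: continuous_subspaceT => t.
  by apply/differentiable_continuous/derivable1_diffP; case: (dpsiP t).
rewrite /psi /dpsi scale1r scale0r addr0 /v (addrC x) subrK -/v.
have c0 : 0 <= c by move: c01; rewrite in_itv/= => /andP[/ltW].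
suff : s * (dotv (g (x + c *: v)) v - dotv (g x) v) <= L * c * sqnorm v by lra.
rewrite -dotvNl -dotvDl.
have s1' : s * dotv (g (x + c *: v) - g x) v <= `|dotv (g (x + c *: v) - g x) v|.
  by rewrite (le_trans (ler_norm _))// normrM ler_piMl.
apply: (le_trans s1'); rewrite -sqr_enorm expr2 mulrA.
have gc : enorm (g (x + c *: v) - g x) <= L * c * enorm v.
  by have := gL (x + c *: v) x; rewrite (addrAC x) subrr add0r enormZ ger0_norm// mulrA.
apply: (@le_trans _ _ (enorm (g (x + c *: v) - g x) * enorm v)); last first.
  by rewrite ler_wpM2r// enorm_ge0.
exact: normr_dotv_enorm_le.
Qed.

Lemma taylor1_upper (f : 'rV[R]_d -> R) (g : 'rV[R]_d -> 'rV[R]_d) (L : R) :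
  is_gradient f g -> L_smooth g L ->
  forall x y, f y <= f x + dotv (g x) (y - x) + L / 2 * sqnorm (y - x).
Proof.
move=> fg gL x y; have := taylor1_le fg gL _ x y (s := 1).
by rewrite normr1 mul1r lexx => /(_ isT); lra.
Qed.

(* Convexity along the segment against the quadratic lower bound at [x]; divide by [t] and
   let [t] tend to 0. *)
Lemma convex_ge_tangent (f : 'rV[R]_d -> R) (g : 'rV[R]_d -> 'rV[R]_d) (L : R) :
  is_gradient f g -> L_smooth g L -> convex_fun f ->
  forall x y, f x + dotv (g x) (y - x) <= f y.
Proof.
move=> fg gL fcv x y; set v := y - x.
have key (t : R) : 0 < t <= 1 ->
    f x + dotv (g x) v - f y <= t * (L / 2 * sqnorm v).
  move=> /andP[t0 t1].
  have := taylor1_le fg gL _ x (t *: y + (1 - t) *: x) (s := -1).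
  have -> : t *: y + (1 - t) *: x - x = t *: v.
    by apply/rowP => j; rewrite !mxE; ring.
  rewrite normrN1 lexx => /(_ isT).
  have := fcv y x t; rewrite ltW// t1 => /(_ isT).
  rewrite dotvZr sqnormZ => h1 h2.
  rewrite -(ler_pM2l t0); lra.
rewrite leNgt; apply/negP => lt_f; set e := f x + dotv (g x) v - f y.
have e0 : 0 < e by rewrite /e; lra.
set c := L / 2 * sqnorm v in key.
(* The minimum keeps [t] in (0, 1], and its second entry forces [t * c <= e / 2], against
   [e <= t * c]; the added 1 keeps the denominator positive. *)
pose t := Num.min 1 (e / (2 * (`|c| + 1))).
have t0 : 0 < t by rewrite lt_min ltr01/= divr_gt0// mulr_gt0// ltr_wpDl.
have t1 : t <= 1 by rewrite ge_min lexx.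
have := key t; rewrite t0 t1 => /(_ isT); rewrite -/e.
have tc : t * c <= e / 2.
  apply: (@le_trans _ _ (e / (2 * (`|c| + 1)) * (`|c| + 1))).
    apply: (@le_trans _ _ (t * (`|c| + 1))).
      by rewrite ler_pM2l//; have := ler_norm c; lra.
    by rewrite ler_wpM2r ?ge_min ?lexx ?orbT// addr_ge0.
  by rewrite invfM mulrA divfK// gt_eqF// ltr_wpDl.
lra.
Qed.

End Euclidean.

(** * Gradient inequalities from a quadratic upper bound and a linear lower bound *)

Section Smooth_convex.
Context {R : realType} {d : nat}.
Variables (f : 'rV[R]_d -> R) (g : 'rV[R]_d -> 'rV[R]_d) (l : R).
Hypothesis l0 : 0 <= l.
Hypothesis f_le : forall x y, f y <= f x + dotv (g x) (y - x) + l / 2 * sqnorm (y - x).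

(** The factor [t - l / 2 * t ^+ 2] is largest at [t = l^-1], with value [1 / (2 * l)]. For [l = 0]
    it is unbounded, and [t = (D + 1) / a] would give [D + 1 <= D] if [a] were positive. *)
Lemma sqr_parabola_le (a D : R) : 0 <= a ->
  (forall t, (t - l / 2 * t ^+ 2) * a <= D) -> a <= 2 * l * D.
Proof.
move=> a0 tD; have D0 : 0 <= D by have := tD 0; lra.
have [l_eq0|lN0] := eqVneq l 0.
  rewrite l_eq0 mulr0 mul0r leNgt; apply/negP => a_gt0.
  by have := tD ((D + 1) / a); rewrite l_eq0 !mul0r subr0 divfK ?gt_eqF//; lra.
have l_gt0 : 0 < l by rewrite lt0r lN0.
have := tD l^-1; have -> : (l^-1 - l / 2 * l^-1 ^+ 2) * a = a / (2 * l) by field.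
by rewrite ler_pdivrMr ?mulr_gt0// mulrC.
Qed.

(** A gradient step of any length [t] cannot go below the minimum, so [sqr_parabola_le] applies with
    [D = 0]. Starting from the quadratic bound lets the lemma serve [avg_fun] and [avg_grad]. *)
Lemma sqnorm_grad_min x : (forall y, f x <= f y) -> g x = 0.
Proof.
move=> x_min; apply/sqnorm_eq0/le_anti; rewrite sqnorm_ge0 andbT.
rewrite -[leRHS](mulr0 (2 * l)); apply: sqr_parabola_le (sqnorm_ge0 _) _ => t.
have := f_le x (x - t *: g x); have := x_min (x - t *: g x).
rewrite (addrAC x) subrr add0r sqnormN sqnormZ dotvNr dotvZr -sqnormE => *; lra.
Qed.

Hypothesis f_ge : forall x y, f x + dotv (g x) (y - x) <= f y.

(* Tangent at [y] against the quadratic upper bound at [x], at the points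
   [x - t (g x - g y)]. *)
Lemma sqnorm_grad_le x y :
  sqnorm (g x - g y) <= 2 * l * (f x - f y - dotv (g y) (x - y)).
Proof.
apply: sqr_parabola_le (sqnorm_ge0 _) _ => t.
set v := g x - g y; set z := x - t *: v.
have := f_le x z; have := f_ge y z.
have -> : z - x = - (t *: v) by rewrite /z addrAC subrr add0r.
have -> : z - y = (x - y) - t *: v by rewrite /z addrAC.
rewrite sqnormN sqnormZ !dotvE => h1 h2.
have : dotv (g x) v - dotv (g y) v = sqnorm v by rewrite sqnormE {3}/v !dotvE.
move=> h; have := congr1 ( *%R t) h; rewrite !dotvE => h'; lra.
Qed.

End Smooth_convex.

(** * Measurable and square-integrable random vectors *)

(** [L_smooth] is Euclidean while neighbourhoods use the sup norm; the two norms agree up to the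
    factor [sqrt d], absorbed in [K]. *)
Lemma L_smooth_continuous (R : realType) (d : nat) (g : 'rV[R]_d -> 'rV[R]_d) (L : R) :
  0 <= L -> L_smooth g L -> continuous g.
Proof.
move=> L0 gL x; set K := L * Num.sqrt d%:R.
have K0 : 0 <= K by rewrite mulr_ge0 ?sqrtr_ge0.
have le_enorm (v : 'rV[R]_d) : `|v| <= enorm v.
  rewrite [leLHS]mx_normrE; apply/bigmax_leP; split=> [|[i j] _] /=.
    exact: enorm_ge0.
  by rewrite ord1 normr_coord_le.
move=> A /nbhs_ballP[e /= e0 eA].
apply/nbhs_ballP; exists (e / (K + 1)) => /=; first by rewrite divr_gt0//; lra.
move=> y; rewrite -ball_normE /= => xy; apply: eA; rewrite -ball_normE /=.
apply: (le_lt_trans (le_enorm _)); apply: (le_lt_trans (gL _ _)).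
have : L * enorm (x - y) <= K * `|x - y|.
  by rewrite /K -mulrA ler_wpM2l// enorm_le_norm.
move=> /le_lt_trans; apply.
apply: (@le_lt_trans _ _ ((K + 1) * `|x - y|)).
  by rewrite ler_wpM2r// lerDl.
by rewrite mulrC -ltr_pdivlMr//; lra.
Qed.

Section mvec.
Context {R : realType} {d : nat} {dT : measure_display} {T : measurableType dT}.
Implicit Types (Y Z : T -> 'rV[R]_d).

(** Coordinatewise, to match [jointly_measurable]; [measurable_vec_preimage_open] recovers preimages
    of open sets. *)
Definition measurable_vec Y := forall j, measurable_fun [set: T] (fun w => Y w 0 j).

Lemma measurable_vec_cst v : measurable_vec (cst v).
Proof. by move=> j; exact: measurable_cst. Qed.

Lemma measurable_vecD Y Z : measurable_vec Y -> measurable_vec Z ->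
  measurable_vec (fun w => Y w + Z w).
Proof.
by move=> mY mZ j; under eq_fun do rewrite mxE; exact: measurable_funD.
Qed.

Lemma measurable_vecZ a Y : measurable_vec Y -> measurable_vec (fun w => a *: Y w).
Proof.
by move=> mY j; under eq_fun do rewrite mxE; exact: measurable_funM.
Qed.

Lemma measurable_vecB Y Z : measurable_vec Y -> measurable_vec Z ->
  measurable_vec (fun w => Y w - Z w).
Proof.
move=> mY mZ; have := measurable_vecD mY (measurable_vecZ (-1) mZ).
by under eq_fun do rewrite scaleN1r.
Qed.

Lemma measurable_vec_sum I (r : seq I) (F : I -> T -> 'rV[R]_d) :
  (forall i, measurable_vec (F i)) -> measurable_vec (fun w => \sum_(i <- r) F i w).
Proof.
move=> mF j; under eq_fun do rewrite summxE.
by apply: measurable_sum => i; exact: mF.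
Qed.

Lemma measurable_dotv Y Z : measurable_vec Y -> measurable_vec Z ->
  measurable_fun [set: T] (fun w => dotv (Y w) (Z w)).
Proof. by move=> mY mZ; apply: measurable_sum => j; exact: measurable_funM. Qed.

Lemma measurable_sqnorm Y : measurable_vec Y ->
  measurable_fun [set: T] (fun w => sqnorm (Y w)).
Proof.
by move=> mY; under eq_fun do rewrite sqnormE; exact: measurable_dotv.
Qed.

(** An open set is the countable union of the boxes with rational centre and radius [m.+1%:R^-1]
    that it contains, and the preimage of a box is a finite intersection of coordinate
    conditions. *)
Lemma measurable_vec_preimage_open Y (U : set 'rV[R]_d) :
  measurable_vec Y -> open U -> measurable (Y @^-1` U).
Proof.
move=> mY oU.
pose box (p : 'rV[rat]_d * nat) : set 'rV[R]_d :=
  [set x | forall j, `|x 0 j - ratr (p.1 0 j)| < p.2.+1%:R^-1].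
have -> : Y @^-1` U =
    \bigcup_(p : 'rV[rat]_d * nat) (if `[< box p `<=` U >] then Y @^-1` box p else set0).
  apply/seteqP; split => w /=; last first.
    by move=> [p _]; case: asboolP => // pU; exact: pU.
  move=> Uw; have /nbhs_ballP[e /= e0 eU] : nbhs (Y w) U by exact: open_nbhs_nbhs.
  (* Two points of one box are less than twice its radius apart, so a radius below [e / 2] keeps the
     box inside the ball of radius [e]. *)
  have [m me] : exists m : nat, m.+1%:R^-1 < e / 2.
    have := @near_infty_natSinv_lt R (PosNum (divr_gt0 e0 (ltr0n _ 2))).
    by move=> [N _ /(_ N (leqnn N))]; exists N.
  have m0 : 0 < m.+1%:R^-1 :> R by rewrite invr_gt0.
  have /choice[q qP] (j : 'I_d) : exists q : rat, `|Y w 0 j - ratr q| < m.+1%:R^-1.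
    have [|q] := @rat_in_itvoo R (Y w 0 j - m.+1%:R^-1) (Y w 0 j + m.+1%:R^-1).
      by rewrite ltrD2l (lt_trans _ m0)// oppr_lt0.
    by rewrite in_itv/= => qI; exists q; rewrite ltr_distlC.
  exists (\row_j q j, m) => //.
  have qw : box (\row_j q j, m) (Y w) by move=> j; rewrite mxE.
  case: asboolP => // -[] x xq; apply: eU; split=> // i j.
  rewrite ord1 /ball/=.
  have := xq j; have := qw j; rewrite !mxE/= => h1 h2.
  rewrite (le_lt_trans (ler_distD (ratr (q j)) _ _))// (distrC _ (x 0 j)).
  by rewrite (splitr e) ltrD// (lt_trans _ me).
apply: countable_bigcupT_measurable => [|p]; first exact: countableP.
case: ifP => // _.
have -> : Y @^-1` box p =
    \big[setI/setT]_(j < d) [set w | `|Y w 0 j - ratr (p.1 0 j)| < p.2.+1%:R^-1].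
  rewrite -bigcap_seq; apply/seteqP; split => w /=; first by move=> h j _; exact: h.
  by move=> h j; apply: h; rewrite /= mem_index_enum.
apply: bigsetI_measurable => j _.
have mj : measurable_fun [set: T] (fun w => `|Y w 0 j - ratr (p.1 0 j)|).
  by apply: measurableT_comp => //; exact: measurable_funB.
have := mj measurableT _ (measurable_itv `]-oo, p.2.+1%:R^-1[).
by rewrite setTI; congr measurable; apply/seteqP; split => w /=; rewrite in_itv.
Qed.

Lemma measurable_comp_continuous Y (f : 'rV[R]_d -> R) :
  measurable_vec Y -> continuous f -> measurable_fun [set: T] (fun w => f (Y w)).
Proof.
move=> mY cf; apply: (measurability _ (RGenOpens.measurableE R)) => //.
move=> _ [_ [a [b ->] <-]]; rewrite setTI.
apply: (measurable_vec_preimage_open (U := f @^-1` `]a, b[)) => //.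
by apply: open_comp => // x _; exact: cf.
Qed.

Lemma measurable_vec_continuous Y (g : 'rV[R]_d -> 'rV[R]_d) :
  measurable_vec Y -> continuous g -> measurable_vec (fun w => g (Y w)).
Proof.
move=> mY cg j; apply: (measurable_comp_continuous (f := fun x => g x 0 j)) => // x.
apply: (@continuous_comp _ _ _ g (fun y : 'rV[R]_d => y 0 j) x (cg x)).
exact: coord_continuous.
Qed.

(** [jointly_measurable] reads vectors as tuples, so [Y] is first turned into the tuple-valued map
    [Z] with the same coordinates. *)
Lemma measurable_vec_joint (dX : measure_display) (X : measurableType dX)
    (Phi : X -> 'rV[R]_d -> 'rV[R]_d) (xi : T -> X) Y :
  jointly_measurable Phi -> measurable_fun [set: T] xi -> measurable_vec Y ->
  measurable_vec (fun w => Phi (xi w) (Y w)).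
Proof.
move=> mPhi mxi mY j.
pose Z w : d.-tuple R := mktuple (Y w 0).
have ZE w : rv_of_tuple (Z w) = Y w by apply/rowP => i; rewrite mxE tnth_mktuple.
have mZ : measurable_fun [set: T] Z.
  apply/measurable_fun_tnthP => i; rewrite (_ : _ \o _ = fun w => Y w 0 i)//.
  by apply/funext => w /=; rewrite tnth_mktuple.
have := measurableT_comp (mPhi j) (measurable_fun_pair mxi mZ).
by congr measurable_fun; apply/funext => w /=; rewrite ZE.
Qed.

End mvec.

(** * Square-integrable random vectors *)

Section sqint.
Context {R : realType} {d : nat} {dO : measure_display} {Omega : measurableType dO}.
Variable P : probability Omega R.
Implicit Types (f g : Omega -> R) (Y Z : Omega -> 'rV[R]_d).

Definition rintegrable f := P.-integrable [set: Omega] (EFin \o f).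

Lemma rintegrable_le f g : measurable_fun [set: Omega] f ->
  (forall w, `|f w| <= g w) -> rintegrable g -> rintegrable f.
Proof.
move=> mf fg; apply: le_integrable => //; first exact/measurable_EFinP.
by move=> w _ /=; rewrite lee_fin (le_trans (fg w)) ?ler_norm.
Qed.

Lemma eq_rintegrable f g : f =1 g -> rintegrable f -> rintegrable g.
Proof. by move=> /funext ->. Qed.

Lemma rintegrableD f g : rintegrable f -> rintegrable g ->
  rintegrable (fun w => f w + g w).
Proof. exact: integrableD. Qed.

Lemma rintegrableZ (a : R) f : rintegrable f -> rintegrable (fun w => a * f w).
Proof. exact: integrableZl. Qed.

Lemma rintegrable_cst (a : R) : rintegrable (fun=> a).
Proof. exact: finite_measure_integrable_cst. Qed.

Lemma expectD f g : rintegrable f -> rintegrable g ->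
  \int[P]_w (f w + g w) = \int[P]_w f w + \int[P]_w g w.
Proof. exact: RintegralD. Qed.

Lemma expectZ (a : R) f : rintegrable f ->
  \int[P]_w (a * f w) = a * \int[P]_w f w.
Proof. by move=> fi; exact: RintegralZl. Qed.

Lemma rintegrable_sum I (r : seq I) (F : I -> Omega -> R) :
  (forall i, rintegrable (F i)) -> rintegrable (fun w => \sum_(i <- r) F i w).
Proof.
move=> iF; elim: r => [|i r ih].
  by apply: eq_rintegrable (rintegrable_cst 0) => w; rewrite big_nil.
by apply: eq_rintegrable (rintegrableD (iF i) ih) => w; rewrite big_cons.
Qed.

Lemma Rintegral_sum I (r : seq I) (F : I -> Omega -> R) :
  (forall i, rintegrable (F i)) ->
  \int[P]_w (\sum_(i <- r) F i w) = \sum_(i <- r) \int[P]_w F i w.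
Proof.
move=> iF; elim: r => [|i r ih].
  rewrite big_nil; under eq_Rintegral do rewrite big_nil.
  by rewrite Rintegral_cst// mul0r.
rewrite big_cons -ih -RintegralD//; [|exact: iF|exact: rintegrable_sum].
by under eq_Rintegral do rewrite big_cons.
Qed.

(** Closed under linear operations and Lipschitz maps, so every iterate can be shown to stay in this
    class, where the cross terms [dotv] are integrable. *)
Definition sqint Y := measurable_vec Y /\ rintegrable (fun w => sqnorm (Y w)).

Lemma sqint_cst v : sqint (cst v).
Proof.
by split; [exact: measurable_vec_cst | exact: (rintegrable_cst (sqnorm v))].
Qed.

Lemma eq_sqint Y Z : Y =1 Z -> sqint Y -> sqint Z.
Proof. by move=> /funext ->. Qed.

Lemma sqintD Y Z : sqint Y -> sqint Z -> sqint (fun w => Y w + Z w).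
Proof.
move=> [mY iY] [mZ iZ]; have mYZ := measurable_vecD mY mZ; split => //.
apply: rintegrable_le (rintegrableD (rintegrableZ 2 iY) (rintegrableZ 2 iZ)).
  exact: measurable_sqnorm.
by move=> w; rewrite ger0_norm ?sqnorm_ge0 ?sqnormD_le.
Qed.

Lemma sqintZ a Y : sqint Y -> sqint (fun w => a *: Y w).
Proof.
move=> [mY iY]; split; first exact: measurable_vecZ.
by apply: eq_rintegrable (rintegrableZ (a ^+ 2) iY) => w; rewrite sqnormZ.
Qed.

Lemma sqintB Y Z : sqint Y -> sqint Z -> sqint (fun w => Y w - Z w).
Proof.
move=> sY sZ; apply: eq_sqint (sqintD sY (sqintZ (-1) sZ)) => w.
by rewrite scaleN1r.
Qed.

Lemma sqint_sum I (r : seq I) (F : I -> Omega -> 'rV[R]_d) :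
  (forall i, sqint (F i)) -> sqint (fun w => \sum_(i <- r) F i w).
Proof.
move=> iF; elim: r => [|i r ih].
  by apply: eq_sqint (sqint_cst 0) => w; rewrite big_nil.
by apply: eq_sqint (sqintD (iF i) ih) => w; rewrite big_cons.
Qed.

Lemma rintegrable_dotv Y Z : sqint Y -> sqint Z ->
  rintegrable (fun w => dotv (Y w) (Z w)).
Proof.
move=> [mY iY] [mZ iZ].
apply: (rintegrable_le (measurable_dotv mY mZ)) (rintegrableD iY iZ) => w.
exact: normr_dotv_le.
Qed.

Lemma Rintegral_sqnormD_orth Y Z : sqint Y -> sqint Z ->
  \int[P]_w dotv (Y w) (Z w) = 0 ->
  \int[P]_w sqnorm (Y w + Z w) = \int[P]_w sqnorm (Y w) + \int[P]_w sqnorm (Z w).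
Proof.
move=> sY sZ YZ0.
under eq_Rintegral do rewrite sqnormD.
have iYZ := rintegrable_dotv sY sZ.
have i2YZ := rintegrableZ 2 iYZ.
rewrite RintegralD//; [|exact: rintegrableD sY.2 i2YZ|exact: sZ.2].
rewrite RintegralD//; last exact: sY.2.
by rewrite RintegralZl// ?YZ0 ?mulr0 ?addr0//; exact: rintegrable_dotv.
Qed.

Lemma Rintegral_sqnormZ a Y : sqint Y ->
  \int[P]_w sqnorm (a *: Y w) = a ^+ 2 * \int[P]_w sqnorm (Y w).
Proof.
by move=> sY; under eq_Rintegral do rewrite sqnormZ; rewrite RintegralZl//; exact: sY.2.
Qed.

(** Pythagoras in L^2, by induction: the head of the list is orthogonal to the sum of the tail. *)
Lemma Rintegral_sqnorm_sum_orth (I : eqType) (r : seq I) (F : I -> Omega -> 'rV[R]_d) :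
  uniq r -> (forall i, sqint (F i)) ->
  (forall i j, i != j -> \int[P]_w dotv (F i w) (F j w) = 0) ->
  \int[P]_w sqnorm (\sum_(i <- r) F i w) = \sum_(i <- r) \int[P]_w sqnorm (F i w).
Proof.
move=> ur sF F0; elim: r ur => [_|i r ih /= /andP[ir ur]].
  rewrite big_nil; under eq_Rintegral do rewrite big_nil -(scale0r 0) sqnormZ.
  by rewrite Rintegral_cst// expr0n/= !mul0r.
rewrite big_cons -ih//; under eq_Rintegral do rewrite big_cons.
apply: Rintegral_sqnormD_orth => //; first exact: sqint_sum.
under eq_Rintegral do rewrite dotv_sumr.
rewrite Rintegral_sum => [|j]; last exact: rintegrable_dotv.
rewrite big_seq big1// => j jr; apply: F0.
by apply: contraNneq ir => ->.
Qed.

End sqint.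

(** * Compression noise and independence *)

Section independence.
Context {R : realType} {dO : measure_display} {Omega : measurableType dO}.
Variable P : probability Omega R.
Context {dA : measure_display} {A : measurableType dA}.
Context {dX : measure_display} {X : measurableType dX}.
Variables (pi : Omega -> A) (xi : Omega -> X).
Hypotheses (mpi : measurable_fun [set: Omega] pi) (mxi : measurable_fun [set: Omega] xi).
Hypothesis indep : forall S B, measurable S -> measurable B ->
  P (pi @^-1` S `&` xi @^-1` B) = (P (pi @^-1` S) * P (xi @^-1` B))%E.

Let pi_mfun : {mfun Omega >-> A} := HB.pack pi (isMeasurableFun.Build _ _ _ _ _ mpi).
Let xi_mfun : {mfun Omega >-> X} := HB.pack xi (isMeasurableFun.Build _ _ _ _ _ mxi).
Let mpair := measurable_fun_pair mpi mxi.
Let pair_mfun : {mfun Omega >-> (A * X)%type} :=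
  HB.pack (fun w => (pi w, xi w)) (isMeasurableFun.Build _ _ _ _ _ mpair).

(** The hypothesis [indep] says that the two measures agree on rectangles, which determine the
    product measure. *)
Lemma joint_distribution_prod S : measurable S ->
  (distribution P pi_mfun \x distribution P xi_mfun)%E S = distribution P pair_mfun S.
Proof.
by move=> mS; apply: product_measure_unique.
Qed.

Local Open Scope ereal_scope.

(** Transport to the product of the two laws, apply Tonelli, and transport back: [xi] is integrated
    in the inner integral with [pi w] frozen. *)
Lemma indep_integral_ge0 (F : (A * X)%type -> \bar R) :
  measurable_fun [set: (A * X)%type] F -> (forall p, 0 <= F p) ->
  \int[P]_w F (pi w, xi w) = \int[P]_w \int[P]_w' F (pi w, xi w').
Proof.
move=> mF F0.
transitivity (\int[distribution P pair_mfun]_p F p).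
  by rewrite ge0_integral_distribution.
rewrite (eq_measure_integral (distribution P pi_mfun \x distribution P xi_mfun)); last first.
  by move=> S mS _; apply/esym; exact: joint_distribution_prod.
rewrite fubini_tonelli1//.
rewrite ge0_integral_distribution//; last 2 first.
  exact: measurable_fun_fubini_tonelli_F.
  by move=> a; exact: integral_ge0.
apply: eq_integral => w _ /=; rewrite /fubini_F ge0_integral_distribution//.
exact: measurableT_comp mF (pair1_measurable _).
Qed.

(** The signed counterpart, by Fubini. Integrability of each section [F (a, xi w)] allows the inner
    integral to be moved to the law of [xi]. *)
Lemma indep_integral_eq0 (F : (A * X)%type -> \bar R) :
  measurable_fun [set: (A * X)%type] F -> P.-integrable setT (fun w => F (pi w, xi w)) ->
  (forall a, P.-integrable setT (fun w => F (a, xi w))) ->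
  (forall a, \int[P]_w F (a, xi w) = 0) ->
  \int[P]_w F (pi w, xi w) = 0.
Proof.
move=> mF iF iFa Fa0.
transitivity (\int[distribution P pair_mfun]_p F p).
  by rewrite integral_distribution.
rewrite (eq_measure_integral (distribution P pi_mfun \x distribution P xi_mfun)); last first.
  by move=> S mS _; apply/esym; exact: joint_distribution_prod.
have iprod : (distribution P pi_mfun \x distribution P xi_mfun).-integrable setT F.
  apply/integrableP; split=> //.
  rewrite (eq_measure_integral (distribution P pair_mfun)); last first.
    by move=> S mS _; exact: joint_distribution_prod.
  rewrite ge0_integral_distribution//; last exact: measurableT_comp.
  by have /integrableP[] := iF.
rewrite -integral12_prod_meas1//.
apply: integral0_eq => a _; rewrite /fubini_F.
rewrite integral_distribution; [exact: Fa0| |exact: iFa].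
exact: measurableT_comp mF (pair1_measurable _).
Qed.

Local Open Scope ring_scope.

Variables (d : nat) (Phi : X -> 'rV[R]_d -> 'rV[R]_d) (om : R) (Y : A -> 'rV[R]_d).
Hypothesis mPhi : jointly_measurable Phi.
Hypothesis PhiB : in_Bd P (fun w => Phi (xi w)) om.
Hypotheses (mY : measurable_vec Y) (sY : sqint P (fun w => Y (pi w))).

Let noise w := Phi (xi w) (Y (pi w)) - Y (pi w).

Let measurable_noise_pair :
  measurable_vec (fun p : (A * X)%type => Phi p.2 (Y p.1) - Y p.1).
Proof.
have mY1 : measurable_vec (fun p : (A * X)%type => Y p.1).
  by move=> j; exact: measurableT_comp (mY j) measurable_fst.
apply: measurable_vecB => //.
exact: measurable_vec_joint mPhi measurable_snd mY1.
Qed.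

(** With [pi w] frozen, the input of the compressor is a fixed vector and the second-moment bound of
    [in_Bd] applies. The integrals are extended-real because integrability of the noise is deduced
    from this bound. *)
Let noise_le : (\int[P]_w (sqnorm (noise w))%:E <= \int[P]_w (om * sqnorm (Y (pi w)))%:E)%E.
Proof.
pose F (p : (A * X)%type) := (sqnorm (Phi p.2 (Y p.1) - Y p.1))%:E.
have mF : measurable_fun setT F.
  by apply/measurable_EFinP; exact: measurable_sqnorm.
have F0 p : (0 <= F p)%E by rewrite lee_fin sqnorm_ge0.
rewrite (indep_integral_ge0 mF F0); apply: ge0_le_integral => //.
- by move=> w _; exact: integral_ge0.
- have := measurable_fun_fubini_tonelli_F (m2 := distribution P xi_mfun) F mF F0.
  move=> /measurableT_comp/(_ mpi); congr measurable_fun; apply/funext => w /=.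
  rewrite /fubini_F ge0_integral_distribution//.
  exact: measurableT_comp mF (pair1_measurable _).
- by apply/measurable_EFinP; apply: measurable_funM => //; exact: measurable_sqnorm sY.1.
- by move=> w _; exact: (PhiB (Y (pi w))).2.
Qed.

Lemma sqint_noise : sqint P noise.
Proof.
have mnoise : measurable_vec noise.
  by move=> j; exact: measurableT_comp (measurable_noise_pair j) mpair.
split=> //; apply/integrableP; split.
  by apply/measurable_EFinP; exact: measurable_sqnorm.
under eq_integral do rewrite /= ger0_norm ?sqnorm_ge0//.
apply: (le_lt_trans noise_le); apply: integrable_lty => //.
exact: (rintegrableZ om sY.2).
Qed.

Lemma Rintegral_sqnorm_noise_le :
  \int[P]_w sqnorm (noise w) <= om * \int[P]_w sqnorm (Y (pi w)).
Proof.
rewrite -RintegralZl//; last exact: sY.2.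
apply: fine_le noise_le; apply: integrable_fin_num => //; first exact: sqint_noise.2.
exact: (rintegrableZ om sY.2).
Qed.

(** With [a] frozen, [Y a] and [Z a] are constants and each coordinate of the noise has mean zero by
    unbiasedness, so the inner integral vanishes. *)
Lemma Rintegral_noise_orth (Z : A -> 'rV[R]_d) :
  measurable_vec Z -> sqint P (fun w => Z (pi w)) ->
  \int[P]_w dotv (noise w) (Z (pi w)) = 0.
Proof.
move=> mZ sZ.
pose F (p : (A * X)%type) := (dotv (Phi p.2 (Y p.1) - Y p.1) (Z p.1))%:E.
have mF : measurable_fun setT F.
  apply/measurable_EFinP; apply: measurable_dotv => // j.
  exact: measurableT_comp (mZ j) measurable_fst.
have iFj a j : P.-integrable setT (fun w => ((Phi (xi w) (Y a) 0 j - Y a 0 j) * Z a 0 j)%:E).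
  have [iC _] := (PhiB (Y a)).1 j.
  apply: eq_integrable (integrableZl measurableT (Z a 0 j)
    (integrableB measurableT iC (rintegrable_cst P (Y a 0 j)))) => // w _ /=.
  by rewrite -EFinB -EFinM mulrC.
have FE a : (fun w => F (a, xi w)) =
    (fun w => (\sum_(j < d) ((Phi (xi w) (Y a) 0 j - Y a 0 j) * Z a 0 j))%:E).
  by apply/funext => w; congr EFin; apply: eq_bigr => j _; rewrite !mxE.
rewrite /Rintegral (indep_integral_eq0 (F := F))//.
- exact: rintegrable_dotv sqint_noise sZ.
- by move=> a; rewrite FE; apply: rintegrable_sum => j; exact: iFj.
- move=> a; rewrite FE.
  under eq_integral do rewrite -sumEFin.
  rewrite integral_sum//; apply: big1 => j _.
  under eq_integral do rewrite EFinM EFinB muleC.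
  have [iC CE] := (PhiB (Y a)).1 j.
  rewrite integralZl//; last by apply: integrableB => //; exact: (rintegrable_cst P (Y a 0 j)).
  rewrite integralB//; last exact: (rintegrable_cst P (Y a 0 j)).
  have -> : (\int[P]_w (Y a 0 j)%:E = (Y a 0 j)%:E)%E.
    by rewrite integral_cst// -[RHS]mule1; congr (_ * _)%E; exact: probability_setT.
  by rewrite CE subee// mule0.
Qed.

End independence.

(** * Independence of one draw from all the others *)

Lemma big_setIP (T : Type) (I : eqType) (s : seq I) (F : I -> set T) w :
  (\big[setI/setT]_(q <- s) F q) w <-> (forall q, q \in s -> F q w).
Proof.
elim: s => [|p s ih]; first by rewrite big_nil; split.
rewrite big_cons; split => [[Fp /ih Fs] q|h].
  by rewrite inE => /predU1P[->//|]; exact: Fs.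
by split; [apply: h; rewrite mem_head | apply/ih => q qs; apply: h; rewrite inE qs orbT].
Qed.

Section cylinders.
Context {R : realType} {dO : measure_display} {Omega : measurableType dO}.
Variable P : probability Omega R.
Context {I : eqType} {dX : measure_display} {X : measurableType dX}.
Variables (xi : I -> Omega -> X) (p : I).
Hypothesis mxi : forall q, measurable_fun [set: Omega] (xi q).
Hypothesis xi_indep : mutually_independent P xi.

(** A pi-system for the draws other than [p]. The index list is duplicate-free and avoids [p], so
    [mutually_independent] applies to [s] and to [p :: s]. *)
Definition cylinders_off : set (set Omega) :=
  [set S | exists (s : seq I) (B : I -> set X), [/\ uniq s, p \notin s,
     forall q, measurable (B q) & S = \big[setI/setT]_(q <- s) (xi q @^-1` B q)]].

Notation G := cylinders_off.

Let mpre q B : measurable B -> measurable (xi q @^-1` B).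
Proof. by move=> mB; rewrite -[X in measurable X]setTI; exact: mxi. Qed.

Lemma cylinders_off_measurable : G `<=` measurable.
Proof.
move=> _ [s [B [_ _ mB ->]]].
by apply: bigsetI_measurable => q _; exact: mpre.
Qed.

Lemma cylinders_off_setI_closed : setI_closed G.
Proof.
move=> _ _ [s1 [B1 [us1 ps1 mB1 ->]]] [s2 [B2 [us2 ps2 mB2 ->]]].
(* Merge the two index lists; an index missing from one of them carries the full set there. *)
exists (undup (s1 ++ s2)).
exists (fun q => (if q \in s1 then B1 q else setT) `&` (if q \in s2 then B2 q else setT)).
split; first exact: undup_uniq.
- by rewrite mem_undup mem_cat negb_or ps1.
- by move=> q; apply: measurableI; case: ifP.
apply/seteqP; split => w /=.
  move=> [/big_setIP h1 /big_setIP h2]; apply/big_setIP => q _.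
  by split; case: ifPn => // qs; [exact: h1|exact: h2].
move=> /big_setIP h; split; apply/big_setIP => q qs; have := h q;
  by rewrite mem_undup mem_cat qs ?orbT => /(_ isT)[].
Qed.

Lemma measurable_xi_off q : q != p ->
  measurable_fun [set: g_sigma_algebraType G] (xi q).
Proof.
move=> qp _ B mB; rewrite setTI; apply: sub_sigma_algebra.
exists [:: q], (fun r => if r == q then B else setT); split => //.
- by rewrite inE eq_sym.
- by move=> r; case: ifP.
- by rewrite big_seq1 eqxx.
Qed.

(** As functions of [S], both sides are finite measures that agree on the pi-system of cylinders,
    hence on the sigma-algebra it generates. *)
Lemma indep_off S B : <<s G >> S -> measurable B ->
  P (S `&` xi p @^-1` B) = (P S * P (xi p @^-1` B))%E.
Proof.
move=> GS mB; have mpB := mpre p mB.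
have GT : G setT by exists [::], (fun=> setT); split => //; rewrite big_nil.
have PBfin : P (xi p @^-1` B) \is a fin_num by exact: fin_num_measure.
have PB0 : 0 <= fine (P (xi p @^-1` B)) by exact: fine_ge0.
pose m1 : {measure set Omega -> \bar R} := mrestr P mpB.
pose m2 : {measure set Omega -> \bar R} := mscale (NngNum PB0) P.
transitivity (m1 S) => //.
transitivity (m2 S); last by rewrite /m2/= /mscale/= fineK// muleC.
apply: (g_sigma_algebra_measure_unique G _ (fun=> setT)) => //.
- exact: cylinders_off_measurable.
- by rewrite bigcup_const.
- exact: cylinders_off_setI_closed.
- move=> _ [s [C [us ps mC ->]]].
  rewrite /m1 /m2/= /mrestr /mscale/= fineK//.
  have sNp q : q \in s -> (q == p) = false by move=> qs; apply: contraNF ps => /eqP <-.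
  (* Independence over [p :: s] and over [s], with this one family, factors out the probability of
     the event at [p]. *)
  pose B' q := if q == p then B else C q.
  have /= := xi_indep (s := p :: s) (B := B').
  rewrite ps us !big_cons /B' eqxx => /(_ isT) indeps.
  have Cs : \big[setI/setT]_(q <- s) (xi q @^-1` (if q == p then B else C q)) =
      \big[setI/setT]_(q <- s) (xi q @^-1` C q).
    by rewrite big_seq [RHS]big_seq; apply: eq_bigr => q /sNp ->.
  rewrite Cs setIC in indeps; rewrite indeps => [|q _]; last by case: ifP.
  congr (_ * _)%E; have := xi_indep (s := s) (B := B') us.
  rewrite /B' Cs => -> // q _; by case: ifP.
- by move=> _; rewrite /m1/= /mrestr setTI ltey_eq PBfin.
Qed.

End cylinders.

(** * The Lyapunov argument *)

Section descent.
Context {R : realType} {d n : nat}.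
Variables (phi : 'I_n -> 'rV[R]_d -> R) (s : 'I_n -> 'rV[R]_d -> 'rV[R]_d) (ell : 'I_n -> R).
Variables (omega beta : 'I_n -> R) (gamma b m1 m2 : R) (xstar : 'rV[R]_d).
Hypothesis n_gt0 : (0 < n)%N.
Hypothesis ell_ge0 : forall i, 0 <= ell i.
Hypothesis phi_le : forall i x y,
  phi i y <= phi i x + dotv (s i x) (y - x) + ell i / 2 * sqnorm (y - x).
Hypothesis phi_ge : forall i x y, phi i x + dotv (s i x) (y - x) <= phi i y.
Hypothesis omega_ge0 : forall i, 0 <= omega i.
Hypothesis beta_range : forall i, 0 < beta i <= (omega i + 1)^-1.
Hypothesis b_gt0 : 0 < b.
Hypothesis b_le : forall i, b <= beta i.
Hypothesis m1_ge : forall i, omega i * ell i <= m1.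
Hypothesis m2_ge : forall i, beta i * omega i * ell i <= m2.
Hypothesis gamma_gt0 : 0 < gamma.

(** This becomes the objective [ft] when [phi i] is [f i] composed with [T i]. Then [b], [m1] and
    [m2] are the minimum and the two maxima in the step-size condition. *)
Definition avg_fun x := n%:R^-1 * \sum_(i < n) phi i x.
(** It acts as the gradient of [avg_fun] through [avg_fun_le] and [avg_fun_ge]. *)
Definition avg_grad x := n%:R^-1 *: \sum_(i < n) s i x.
Let La := n%:R^-1 * \sum_(i < n) ell i.
Definition gap x := avg_fun x - avg_fun xstar.

Hypothesis gamma_le : gamma * (La + 2 * m1 / n%:R + 4 * m2 / (n%:R * b)) <= 4^-1.
Hypothesis xstar_min : is_minimizer avg_fun xstar.

Let N_gt0 : 0 < n%:R :> R. Proof. by rewrite ltr0n. Qed.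

Lemma avg_fun_le x y :
  avg_fun y <= avg_fun x + dotv (avg_grad x) (y - x) + La / 2 * sqnorm (y - x).
Proof.
rewrite /avg_fun /avg_grad /La dotvZl dotv_suml.
have -> : n%:R^-1 * (\sum_(i < n) ell i) / 2 * sqnorm (y - x) =
    n%:R^-1 * \sum_(i < n) (ell i / 2 * sqnorm (y - x)).
  rewrite -!mulrA mulr_suml; congr (_ * _).
  by apply: eq_bigr => i _; rewrite mulrA.
rewrite -!mulrDr -!big_split ler_pM2l ?invr_gt0//.
by apply: ler_sum => i _; exact: phi_le.
Qed.

Lemma avg_fun_ge x y : avg_fun x + dotv (avg_grad x) (y - x) <= avg_fun y.
Proof.
rewrite /avg_fun /avg_grad dotvZl dotv_suml.
rewrite -!mulrDr -!big_split ler_pM2l ?invr_gt0//.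
by apply: ler_sum => i _; exact: phi_ge.
Qed.

Lemma gap_ge0 x : 0 <= gap x.
Proof. by rewrite subr_ge0. Qed.

Let La_ge0 : 0 <= La.
Proof. by rewrite mulr_ge0 ?invr_ge0 ?ler0n//; apply: sumr_ge0. Qed.

Lemma avg_grad_star : avg_grad xstar = 0.
Proof. exact: (sqnorm_grad_min La_ge0 avg_fun_le). Qed.

Lemma gap_le x : gap x <= La / 2 * sqnorm (x - xstar).
Proof.
by have := avg_fun_le xstar x; rewrite avg_grad_star dotv0l /gap; lra.
Qed.

(** Jensen's inequality: sum the tangent inequalities at the mean point, where the linear terms
    cancel. *)
Lemma avg_fun_mean (r : seq nat) (x : nat -> 'rV[R]_d) : (0 < size r)%N ->
  gap ((size r)%:R^-1 *: \sum_(j <- r) x j) <=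
  (size r)%:R^-1 * \sum_(j <- r) gap (x j).
Proof.
move=> r0; have r_gt0 : 0 < (size r)%:R :> R by rewrite ltr0n.
set xb := _ *: _.
have : \sum_(j <- r) (gap xb + dotv (avg_grad xb) (x j - xb)) <= \sum_(j <- r) gap (x j).
  by apply: ler_sum => j _; have := avg_fun_ge xb (x j); rewrite /gap; lra.
have x0 : \sum_(j <- r) (x j - xb) = 0.
  rewrite sumrB big_const_seq count_predT iter_addr_0 -scaler_nat scalerA.
  by rewrite mulfV ?gt_eqF// scale1r subrr.
rewrite big_split/= -dotv_sumr x0 dotvC dotv0l addr0 big_const_seq count_predT iter_addr_0.
by rewrite -[gap xb *+ _]mulr_natl -ler_pdivlMl.
Qed.

Let breg i x := phi i x - phi i xstar - dotv (s i xstar) (x - xstar).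

Let breg_ge0 i x : 0 <= breg i x.
Proof. by have := phi_ge i xstar x; rewrite /breg; lra. Qed.

(** The linear parts add up to a multiple of [avg_grad xstar], which is zero. *)
Let sum_breg x : \sum_(i < n) breg i x = n%:R * gap x.
Proof.
have := congr1 (fun v => dotv v (x - xstar)) avg_grad_star.
rewrite dotv0l /avg_grad dotvZl dotv_suml => /eqP.
rewrite mulf_eq0 invr_eq0 gt_eqF//= => /eqP s0.
rewrite /breg !sumrB s0 subr0 /gap /avg_fun -mulrBr mulrA mulfV ?gt_eqF// mul1r.
by [].
Qed.

Let grad_diff_le i x : sqnorm (s i x - s i xstar) <= 2 * ell i * breg i x.
Proof. exact: (sqnorm_grad_le (ell_ge0 i) (phi_le i) (phi_ge i)). Qed.

(** Used with weights [omega] and [beta * omega], which is how the two maxima enter the step-size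
    condition. *)
Let weighted_grad_diff_le (c : 'I_n -> R) m x : (forall i, 0 <= c i) ->
  (forall i, c i * ell i <= m) ->
  \sum_(i < n) c i * sqnorm (s i x - s i xstar) <= 2 * m * n%:R * gap x.
Proof.
move=> c0 cm; rewrite -mulrA -sum_breg mulr_sumr; apply: ler_sum => i _.
apply: (@le_trans _ _ (c i * (2 * ell i * breg i x))).
  by rewrite ler_wpM2l// grad_diff_le.
have := ler_wpM2r (breg_ge0 i x) (cm i); lra.
Qed.

(** The left side is the squared distance after the mean update of the shift, plus the variance
    bound for its noise. *)
Let shift_le i (x h : 'rV[R]_d) :
  sqnorm (h + beta i *: (s i x - h) - s i xstar) + beta i ^+ 2 * omega i * sqnorm (s i x - h)
  <= (1 - beta i) * sqnorm (h - s i xstar) + beta i * sqnorm (s i x - s i xstar).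
Proof.
have /andP[b0 b1] := beta_range i.
set p := s i x - s i xstar; set q := h - s i xstar.
have -> : s i x - h = p - q by rewrite /p /q; apply/rowP => j; rewrite !mxE; ring.
have -> : h + beta i *: (p - q) - s i xstar = q + beta i *: (p - q).
  by rewrite /q addrAC.
rewrite sqnormD sqnormZ dotvZr.
(* The choice of [beta] makes [beta^2 (1 + omega)] at most [beta], so the errors complete a
   convex combination of the squares. *)
have bb : beta i ^+ 2 * (omega i + 1) <= beta i.
  rewrite expr2 -mulrA -[leRHS]mulr1 ler_wpM2l ?(ltW b0)//.
  by rewrite -ler_pdivlMr ?div1r//; have := omega_ge0 i; lra.
have := ler_wpM2r (sqnorm_ge0 (p - q)) bb.
have -> : dotv q (p - q) = dotv p q - sqnorm q by rewrite dotvDr dotvNr (dotvC q p) sqnormE.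
rewrite sqnormB => h1.
have := sqnorm_ge0 p; lra.
Qed.

(* Chosen so that the contraction [c * b] of the shift terms pays for their contribution
   [2 (gamma / n)^2] to the variance of the gradient estimator. *)
Definition lyapunov_weight := 4 * gamma ^+ 2 / (n%:R ^+ 2 * b).
Notation c := lyapunov_weight.

(* The left-hand side is the expected Lyapunov function after one step from [(x, h)], with the
   variance of each compression error replaced by its bound. *)
Lemma descent_step (x : 'rV[R]_d) (h : 'I_n -> 'rV[R]_d) :
  sqnorm (x - xstar - gamma *: avg_grad x)
  + (gamma / n%:R) ^+ 2 * (\sum_(i < n) omega i * sqnorm (s i x - h i))
  + c * (\sum_(i < n) omega i *
      (sqnorm (h i + beta i *: (s i x - h i) - s i xstar)
       + beta i ^+ 2 * omega i * sqnorm (s i x - h i)))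
  <= sqnorm (x - xstar) + c * (\sum_(i < n) omega i * sqnorm (h i - s i xstar))
     - gamma * gap x.
Proof.
(* The usual estimate for an exact gradient step, from convexity and
   [|avg_grad x|^2 <= 2 La gap x]. *)
have x_le : sqnorm (x - xstar - gamma *: avg_grad x) <=
    sqnorm (x - xstar) - 2 * gamma * gap x + gamma ^+ 2 * (2 * La * gap x).
  rewrite (sqnormB (x - xstar)) sqnormZ dotvZr (dotvC (x - xstar)).
  have h1 : gap x <= dotv (avg_grad x) (x - xstar).
    have := avg_fun_ge x xstar; rewrite -opprB dotvNr /gap; lra.
  have h2 : sqnorm (avg_grad x) <= 2 * La * gap x.
    have := sqnorm_grad_le La_ge0 avg_fun_le avg_fun_ge x xstar.
    by rewrite avg_grad_star dotv0l !subr0.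
  have := ler_wpM2l (ltW gamma_gt0) h1; have := ler_wpM2l (sqr_ge0 gamma) h2; lra.
set Sg := \sum_(i < n) omega i * sqnorm (h i - s i xstar).
set A1 := \sum_(i < n) omega i * sqnorm (s i x - s i xstar).
set A2 := \sum_(i < n) (beta i * omega i) * sqnorm (s i x - s i xstar).
have A1_le : A1 <= 2 * m1 * n%:R * gap x by exact: weighted_grad_diff_le.
have A2_le : A2 <= 2 * m2 * n%:R * gap x.
  by apply: weighted_grad_diff_le => // i; rewrite mulr_ge0//; have /andP[/ltW] := beta_range i.
have delta_le : \sum_(i < n) omega i * sqnorm (s i x - h i) <= 2 * A1 + 2 * Sg.
  rewrite /A1 /Sg !mulr_sumr -big_split; apply: ler_sum => i _ /=.
  have -> : s i x - h i = (s i x - s i xstar) + - (h i - s i xstar).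
    by apply/rowP => j; rewrite !mxE; ring.
  have := ler_wpM2l (omega_ge0 i) (sqnormD_le (s i x - s i xstar) (- (h i - s i xstar))).
  rewrite sqnormN; lra.
have shift_sum : \sum_(i < n) omega i *
      (sqnorm (h i + beta i *: (s i x - h i) - s i xstar)
       + beta i ^+ 2 * omega i * sqnorm (s i x - h i)) <= Sg - b * Sg + A2.
  rewrite /A2 /Sg !mulr_sumr -sumrB -big_split; apply: ler_sum => i _ /=.
  have := ler_wpM2l (omega_ge0 i) (shift_le i x (h i)).
  have q0 : 0 <= omega i * sqnorm (h i - s i xstar) by rewrite mulr_ge0 ?sqnorm_ge0.
  have := ler_wpM2r q0 (b_le i); lra.
have c_ge0 : 0 <= c.
  by rewrite divr_ge0 ?mulr_ge0 ?sqr_ge0 ?ltW.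
have := ler_wpM2l (sqr_ge0 (gamma / n%:R)) delta_le.
have := ler_wpM2l (sqr_ge0 (gamma / n%:R)) A1_le.
have := ler_wpM2l c_ge0 shift_sum; have := ler_wpM2l c_ge0 A2_le.
have Sg0 : 0 <= Sg by apply: sumr_ge0 => i _; rewrite mulr_ge0 ?sqnorm_ge0.
have := mulr_ge0 (sqr_ge0 (gamma / n%:R)) Sg0.
have cb : c * (b * Sg) = 4 * (gamma / n%:R) ^+ 2 * Sg.
  by rewrite /c; field; rewrite !gt_eqF.
have E1 : (gamma / n%:R) ^+ 2 * (2 * m1 * n%:R * gap x) =
    gamma * gap x * (gamma * (2 * m1 / n%:R)).
  by field; rewrite gt_eqF.
have E2 : c * (2 * m2 * n%:R * gap x) =
    2 * (gamma * gap x * (gamma * (4 * m2 / (n%:R * b)))).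
  by rewrite /c; field; rewrite !gt_eqF.
have gg : 0 <= gamma * gap x by rewrite mulr_ge0 ?gap_ge0 ?ltW.
(* The coefficients of [gap x] add up to [-2 gamma] plus [2 gamma] times the left side of
   [gamma_le], hence to at most [-3/2 gamma]. *)
have := ler_wpM2l gg gamma_le.
move: cb E1 E2; set c' := c; set g2 := (gamma / n%:R) ^+ 2.
set t1 := 2 * m1 / n%:R; set t2 := 4 * m2 / _.
move=> cb E1 E2 *; lra.
Qed.

(** * The Lyapunov step in expectation *)

Hypothesis phi_cont : forall i, continuous (phi i).
Hypothesis s_smooth : forall i, L_smooth (s i) (ell i).

Lemma measurable_gap {dT : measure_display} {T : measurableType dT} (x : T -> 'rV[R]_d) :
  measurable_vec x -> measurable_fun [set: T] (fun w => gap (x w)).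
Proof.
move=> mx; apply: measurable_funB => //; apply: measurable_funM => //.
by apply: measurable_sum => i; exact: measurable_comp_continuous.
Qed.

Lemma measurable_grad {dT : measure_display} {T : measurableType dT} i (x : T -> 'rV[R]_d) :
  measurable_vec x -> measurable_vec (fun w => s i (x w)).
Proof.
move=> mx; apply: measurable_vec_continuous => //.
exact: L_smooth_continuous (ell_ge0 i) (s_smooth i).
Qed.

Section expectation.
Context {dO : measure_display} {Omega : measurableType dO}.
Variable P : probability Omega R.

(** By the Lipschitz bound, [s i (x w)] stays within [ell i] times the distance from [x w] to
    [xstar] of a constant vector. *)
Lemma sqint_grad i (x : Omega -> 'rV[R]_d) : sqint P x -> sqint P (fun w => s i (x w)).
Proof.
move=> sx; have smx := measurable_grad i sx.1.
have sxx := sqintB sx (sqint_cst P xstar).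
have sdiff : sqint P (fun w => s i (x w) - s i xstar).
  have md := measurable_vecB smx (measurable_vec_cst (s i xstar)).
  split => //; apply: rintegrable_le (rintegrableZ (ell i ^+ 2) sxx.2).
    exact: measurable_sqnorm.
  by move=> w; rewrite ger0_norm ?sqnorm_ge0//; exact: L_smooth_sqnorm.
by apply: eq_sqint (sqintD sdiff (sqint_cst P (s i xstar))) => w; rewrite subrK.
Qed.

Lemma sqint_avg_grad (x : Omega -> 'rV[R]_d) : sqint P x ->
  sqint P (fun w => avg_grad (x w)).
Proof.
by move=> sx; apply: sqintZ; apply: sqint_sum => i; exact: sqint_grad.
Qed.

Lemma rintegrable_gap (x : Omega -> 'rV[R]_d) : sqint P x ->
  rintegrable P (fun w => gap (x w)).
Proof.
move=> sx; have sxx := sqintB sx (sqint_cst P xstar).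
apply: rintegrable_le (rintegrableZ (La / 2) sxx.2); first exact: measurable_gap sx.1.
by move=> w; rewrite ger0_norm ?gap_ge0 ?gap_le.
Qed.

Definition lyapunov (x : Omega -> 'rV[R]_d) (h : 'I_n -> Omega -> 'rV[R]_d) :=
  \int[P]_w sqnorm (x w - xstar)
  + c * \sum_(i < n) omega i * \int[P]_w sqnorm (h i w - s i xstar).

Variables (x : Omega -> 'rV[R]_d) (h D : 'I_n -> Omega -> 'rV[R]_d).
Hypotheses (sx : sqint P x) (sh : forall i, sqint P (h i)) (sD : forall i, sqint P (D i)).
Let Delta i w := s i (x w) - h i w.
Let u w := x w - xstar - gamma *: avg_grad (x w).
Let v i w := h i w + beta i *: Delta i w - s i xstar.
Hypothesis D_le : forall i,
  \int[P]_w sqnorm (D i w) <= omega i * \int[P]_w sqnorm (Delta i w).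
Hypothesis D_orth : forall i j, i != j -> \int[P]_w dotv (D i w) (D j w) = 0.
Hypothesis D_u : forall i, \int[P]_w dotv (D i w) (u w) = 0.
Hypothesis D_v : forall i, \int[P]_w dotv (D i w) (v i w) = 0.

(** [u] and [v] are the noiseless updates measured from their targets. Orthogonality removes every
    cross term, leaving the energies of the [D i]. *)
Lemma lyapunov_step :
  lyapunov
    (fun w => x w - gamma *: (n%:R^-1 *: \sum_(i < n) (h i w + (Delta i w + D i w))))
    (fun i w => h i w + beta i *: (Delta i w + D i w))
  <= lyapunov x h - gamma * \int[P]_w gap (x w).
Proof.
have sDelta i : sqint P (Delta i) by exact: sqintB (sqint_grad i sx) (sh i).
have su : sqint P u.
  apply: sqintB; first exact: sqintB sx (sqint_cst P xstar).
  by apply: sqintZ; exact: sqint_avg_grad.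
have sv i : sqint P (v i).
  by apply: sqintB (sqint_cst P _); apply: sqintD => //; exact: sqintZ.
have xE : \int[P]_w sqnorm (x w -
      gamma *: (n%:R^-1 *: \sum_(i < n) (h i w + (Delta i w + D i w))) - xstar) =
    \int[P]_w sqnorm (u w) + (gamma / n%:R) ^+ 2 * \sum_(i < n) \int[P]_w sqnorm (D i w).
  (* Since [h + Delta] is the exact gradient [s i x], the update is a gradient step plus scaled
     noise. *)
  transitivity (\int[P]_w sqnorm (u w + (- (gamma / n%:R)) *: \sum_(i < n) D i w)).
    apply: eq_Rintegral => w _; congr sqnorm.
    rewrite /u /avg_grad /Delta.
    under eq_bigr do rewrite addrA [h _ _ + _]addrC subrK.
    rewrite big_split/= !scalerDr scaleNr scalerA; apply/rowP => j; rewrite !mxE; ring.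
  have sS : sqint P (fun w => \sum_(i < n) D i w) by exact: sqint_sum.
  rewrite Rintegral_sqnormD_orth//; [|exact: sqintZ|].
    rewrite Rintegral_sqnormZ// sqrrN; congr (_ + _ * _).
    by rewrite Rintegral_sqnorm_sum_orth ?index_enum_uniq.
  under eq_Rintegral do rewrite dotvZr dotv_sumr.
  have iud i : rintegrable P (fun w => dotv (u w) (D i w)) by exact: rintegrable_dotv.
  rewrite expectZ//; last exact: rintegrable_sum.
  rewrite Rintegral_sum// big1 ?mulr0// => i _.
  by under eq_Rintegral do rewrite dotvC.
have hE i : \int[P]_w sqnorm (h i w + beta i *: (Delta i w + D i w) - s i xstar) =
    \int[P]_w sqnorm (v i w) + beta i ^+ 2 * \int[P]_w sqnorm (D i w).
  transitivity (\int[P]_w sqnorm (v i w + beta i *: D i w)).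
    apply: eq_Rintegral => w _; congr sqnorm.
    by rewrite /v; apply/rowP => j; rewrite !mxE; ring.
  rewrite Rintegral_sqnormD_orth ?Rintegral_sqnormZ//; first exact: sqintZ.
  under eq_Rintegral do rewrite dotvZr dotvC.
  by rewrite expectZ ?D_v ?mulr0//; exact: rintegrable_dotv.
have c_ge0 : 0 <= c by rewrite divr_ge0 ?mulr_ge0 ?sqr_ge0 ?ltW.
have iu := su.2; have iDelta i := (sDelta i).2; have iv i := (sv i).2.
have ixx := (sqintB sx (sqint_cst P xstar)).2.
have ihs i := (sqintB (sh i) (sqint_cst P (s i xstar))).2.
pose f1 w := \sum_(i < n) omega i * sqnorm (Delta i w).
pose f2 w := \sum_(i < n) omega i *
  (sqnorm (v i w) + beta i ^+ 2 * omega i * sqnorm (Delta i w)).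
pose f3 w := \sum_(i < n) omega i * sqnorm (h i w - s i xstar).
have if2i i : rintegrable P
    (fun w => sqnorm (v i w) + beta i ^+ 2 * omega i * sqnorm (Delta i w)).
  by apply: rintegrableD => //; exact: rintegrableZ.
have if1 : rintegrable P f1 by apply: rintegrable_sum => i; exact: rintegrableZ.
have if2 : rintegrable P f2 by apply: rintegrable_sum => i; exact: rintegrableZ.
have if3 : rintegrable P f3 by apply: rintegrable_sum => i; exact: rintegrableZ.
have igap := rintegrable_gap sx.
have Ef1 : \int[P]_w f1 w = \sum_(i < n) omega i * \int[P]_w sqnorm (Delta i w).
  rewrite Rintegral_sum => [|i]; last exact: rintegrableZ.
  by apply: eq_bigr => i _; rewrite expectZ.
have Ef2 : \int[P]_w f2 w = \sum_(i < n) omega i *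
    (\int[P]_w sqnorm (v i w) + beta i ^+ 2 * omega i * \int[P]_w sqnorm (Delta i w)).
  rewrite Rintegral_sum => [|i]; last exact: rintegrableZ.
  apply: eq_bigr => i _; rewrite expectZ//; congr (_ * _).
  by rewrite expectD// ?expectZ//; exact: rintegrableZ.
have Ef3 : \int[P]_w f3 w = \sum_(i < n) omega i * \int[P]_w sqnorm (h i w - s i xstar).
  rewrite Rintegral_sum => [|i]; last exact: rintegrableZ.
  by apply: eq_bigr => i _; rewrite expectZ.
have : \int[P]_w (sqnorm (u w) + (gamma / n%:R) ^+ 2 * f1 w + c * f2 w) <=
       \int[P]_w (sqnorm (x w - xstar) + c * f3 w + (- gamma) * gap (x w)).
  apply: le_Rintegral => //.
  - by do 2?apply: rintegrableD => //; exact: rintegrableZ.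
  - by do 2?apply: rintegrableD => //; exact: rintegrableZ.
  - by move=> w _; rewrite mulNr; exact: descent_step.
have if1' := rintegrableZ ((gamma / n%:R) ^+ 2) if1.
have if2' := rintegrableZ c if2; have if3' := rintegrableZ c if3.
have igap' := rintegrableZ (- gamma) igap.
rewrite (expectD (rintegrableD iu if1') if2') (expectD iu if1').
rewrite (expectD (rintegrableD ixx if3') igap') (expectD ixx if3') !expectZ//.
rewrite Ef1 Ef2 Ef3 /lyapunov xE mulNr => /(le_trans _); apply.
(* The noise energies from [xE] and [hE] are now replaced by their bounds [D_le]. *)
rewrite -!addrA lerD2l; apply: lerD.
  by rewrite ler_wpM2l ?sqr_ge0//; apply: ler_sum.
rewrite ler_wpM2l//; apply: ler_sum => i _; rewrite hE ler_wpM2l//.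
by rewrite lerD2l -mulrA ler_wpM2l ?sqr_ge0.
Qed.

End expectation.

(** * The DIANA iterates as random vectors *)

Variables (alpha : 'I_n -> R) (T gf : 'I_n -> 'rV[R]_d -> 'rV[R]_d).
Hypothesis sE : forall i x, alpha i *: gf i (T i x) = s i x.
Context {dX : measure_display} {X : measurableType dX}.
Variable Phi : nat -> 'I_n -> X -> 'rV[R]_d -> 'rV[R]_d.
Hypothesis Phi_meas : forall k i, jointly_measurable (Phi k i).
Variables (x0 : 'rV[R]_d) (h0 : 'I_n -> 'rV[R]_d).

(** Adaptedness: the state at [k] depends on the draws before [k]. The domain [T'] is arbitrary so
    that it can be [Omega] with a smaller sigma-algebra. *)
Lemma measurable_diana {dT : measure_display} {T' : measurableType dT}
    (z : nat -> 'I_n -> T' -> X) (k : nat) :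
  (forall l i, (l < k)%N -> measurable_fun [set: T'] (z l i)) ->
  let st w := diana alpha beta gamma T gf x0 h0 (fun l i => Phi l i (z l i w)) k in
  measurable_vec (fun w => (st w).1) /\ forall i, measurable_vec (fun w => (st w).2 i).
Proof.
elim: k => [|k ih] mz /=.
  by split=> [|i]; exact: measurable_vec_cst.
have [|mx mh] := ih; first by move=> l i lk; apply: mz; rewrite ltnS ltnW.
have mD i : measurable_vec (fun w => Phi k i (z k i w) (
    alpha i *: gf i (T i (diana alpha beta gamma T gf x0 h0
      (fun l i => Phi l i (z l i w)) k).1) -
    (diana alpha beta gamma T gf x0 h0 (fun l i => Phi l i (z l i w)) k).2 i)).
  apply: measurable_vec_joint => //; first exact: mz.
  apply: measurable_vecB => //.
  by have := measurable_grad i mx; congr measurable_vec; apply/funext => w; rewrite sE.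
split=> [|i]; last by apply: measurable_vecD => //; exact: measurable_vecZ.
apply: measurable_vecB => //; do 2 apply: measurable_vecZ.
by apply: measurable_vec_sum => i; exact: measurable_vecD.
Qed.

Section rate.
Context {dO : measure_display} {Omega : measurableType dO}.
Variable P : probability Omega R.
Variable xi : nat -> 'I_n -> Omega -> X.
Hypothesis xi_meas : forall k i, measurable_fun [set: Omega] (xi k i).
Hypothesis xi_indep : mutually_independent P (fun p : nat * 'I_n => xi p.1 p.2).
Hypothesis C_in_B : forall k i, in_Bd P (fun w => Phi k i (xi k i w)) (omega i).

Let st k w := diana alpha beta gamma T gf x0 h0 (fun l i => Phi l i (xi l i w)) k.
Let Xk k w := (st k w).1.
Let Hk k i w := (st k w).2 i.
Let Delta k i w := s i (Xk k w) - Hk k i w.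
Let D k i w := Phi k i (xi k i w) (Delta k i w) - Delta k i w.

Let XkS k w : Xk k.+1 w =
  Xk k w - gamma *: (n%:R^-1 *: \sum_(i < n) (Hk k i w + (Delta k i w + D k i w))).
Proof.
rewrite /Xk /= -/(st k w) -/(Xk k w); congr (_ - _ *: (_ *: _)).
apply: eq_bigr => i _; rewrite sE -/(Hk k i w) -/(Delta k i w).
by rewrite /D [_ + (_ - _)]addrC subrK.
Qed.

Let HkS k i w : Hk k.+1 i w = Hk k i w + beta i *: (Delta k i w + D k i w).
Proof.
rewrite /Hk /= -/(st k w) -/(Hk k i w) sE -/(Xk k w) -/(Delta k i w).
by rewrite /D [_ + (_ - _)]addrC subrK.
Qed.

(* All the randomness except that of the compressor [(k, i)]. *)
Let Off k i := g_sigma_algebraType (cylinders_off (fun p => xi p.1 p.2) (k, i)).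

(** The independence lemmas are used with [pi] the identity from [Omega] to the same set with the
    coarser sigma-algebra; this replaces conditioning. *)
Let mid k i : measurable_fun [set: Omega] (id : Omega -> Off k i).
Proof.
move=> _ B mB; rewrite setTI preimage_id.
apply: (smallest_sub (@sigma_algebra_measurable _ Omega)) mB.
by apply: cylinders_off_measurable => q; exact: xi_meas.
Qed.

Let indep_id k i (S : set (Off k i)) (B : set X) : measurable S -> measurable B ->
  P ((id : Omega -> Off k i) @^-1` S `&` xi k i @^-1` B) =
  (P ((id : Omega -> Off k i) @^-1` S) * P (xi k i @^-1` B))%E.
Proof.
by move=> mS mB; apply: (indep_off (p := (k, i)) (fun q => xi_meas q.1 q.2)).
Qed.

Let mDelta k i j : measurable_vec (T := Off k i) (Delta k j).
Proof.
have [|mx mh] := @measurable_diana _ (Off k i) xi k.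
  move=> l m lk; apply: (measurable_xi_off (q := (l, m))).
  by rewrite xpair_eqE negb_and (ltn_eqF lk).
by apply: measurable_vecB; [exact: measurable_grad mx | exact: mh].
Qed.

Let mX k i : measurable_vec (T := Off k i) (Xk k).
Proof.
have [|//] := @measurable_diana _ (Off k i) xi k.
move=> l m lk; apply: (measurable_xi_off (q := (l, m))).
by rewrite xpair_eqE negb_and (ltn_eqF lk).
Qed.

Let mH k i j : measurable_vec (T := Off k i) (Hk k j).
Proof.
have [|_ mh] := @measurable_diana _ (Off k i) xi k; last exact: mh.
move=> l m lk; apply: (measurable_xi_off (q := (l, m))).
by rewrite xpair_eqE negb_and (ltn_eqF lk).
Qed.

(** Errors of other workers in the same round avoid the draw [(k, i)], so they are admissible as [Z]
    in [D_orth]; this gives pairwise orthogonality. *)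
Let mD k i j : j != i -> measurable_vec (T := Off k i) (D k j).
Proof.
move=> ji; apply: measurable_vecB => //; apply: measurable_vec_joint => //.
by apply: (measurable_xi_off (q := (k, j))); rewrite xpair_eqE negb_and ji orbT.
Qed.

Let sqint_D k i : sqint P (Delta k i) -> sqint P (D k i).
Proof.
move=> sDelta.
exact: (sqint_noise (@mid k i) (xi_meas k i) (@indep_id k i) (Phi_meas k i)
  (C_in_B k i) (@mDelta k i i) sDelta).
Qed.

Let D_le k i : sqint P (Delta k i) ->
  \int[P]_w sqnorm (D k i w) <= omega i * \int[P]_w sqnorm (Delta k i w).
Proof.
move=> sDelta.
exact: (Rintegral_sqnorm_noise_le (@mid k i) (xi_meas k i) (@indep_id k i) (Phi_meas k i)
  (C_in_B k i) (@mDelta k i i) sDelta).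
Qed.

Let D_orth k i Z : sqint P (Delta k i) -> measurable_vec (T := Off k i) Z ->
  sqint P Z -> \int[P]_w dotv (D k i w) (Z w) = 0.
Proof.
move=> sDelta mZ sZ.
exact: (Rintegral_noise_orth (@mid k i) (xi_meas k i) (@indep_id k i) (Phi_meas k i)
  (C_in_B k i) (@mDelta k i i) sDelta mZ sZ).
Qed.

(** Square integrability of the state passes to [Delta], then to the noise by [sqint_D], then to the
    next state. *)
Let sqint_st k : sqint P (Xk k) /\ forall i, sqint P (Hk k i).
Proof.
elim: k => [|k [sX sH]].
  by split=> [|i]; exact: sqint_cst.
have sDelta i : sqint P (Delta k i) by apply: sqintB => //; exact: sqint_grad.
have sDD i : sqint P (fun w => Delta k i w + D k i w) by apply: sqintD => //; exact: sqint_D.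
split=> [|i].
  apply: (eq_sqint (fun w => esym (XkS k w))); apply: sqintB => //.
  by do 2 apply: sqintZ; apply: sqint_sum => i; exact: sqintD.
apply: (eq_sqint (fun w => esym (HkS k i w))); apply: sqintD => //.
exact: sqintZ.
Qed.

Let lyapunov_stS k : lyapunov P (Xk k.+1) (Hk k.+1) <=
  lyapunov P (Xk k) (Hk k) - gamma * \int[P]_w gap (Xk k w).
Proof.
have [sX sH] := sqint_st k.
have sDelta i : sqint P (Delta k i) by apply: sqintB => //; exact: sqint_grad.
have -> : Xk k.+1 = _ := funext (XkS k).
have -> : Hk k.+1 = _ := funext (fun i => funext (HkS k i)).
apply: lyapunov_step => // [i|i|i j ij|i|i].
- exact: sqint_D.
- exact: D_le.
- by apply: D_orth; [exact: sDelta|apply: mD; rewrite eq_sym|exact: sqint_D].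
- apply: D_orth => //.
    apply: measurable_vecB; first exact: measurable_vecB (@mX k i) (measurable_vec_cst _).
    apply: measurable_vecZ; apply: measurable_vecZ; apply: measurable_vec_sum => j.
    exact: measurable_grad.
  apply: sqintB; first exact: sqintB sX (sqint_cst P xstar).
  by apply: sqintZ; exact: sqint_avg_grad.
- apply: D_orth => //.
    apply: measurable_vecB (measurable_vec_cst _); apply: measurable_vecD => //.
    by apply: measurable_vecZ; exact: mDelta.
  apply: sqintB (sqint_cst P _); apply: sqintD (sqintZ _ (sDelta i)); exact: sH.
Qed.

Let lyapunov_ge0 k : 0 <= lyapunov P (Xk k) (Hk k).
Proof.
have E0 (f : Omega -> R) : (forall w, 0 <= f w) -> 0 <= \int[P]_w f w.
  by move=> f0; apply: Rintegral_ge0.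
apply: addr_ge0; first by apply: E0 => w; exact: sqnorm_ge0.
apply: mulr_ge0; first by rewrite divr_ge0 ?mulr_ge0 ?sqr_ge0 ?ltW.
apply: sumr_ge0 => i _; apply: mulr_ge0 => //.
by apply: E0 => w; exact: sqnorm_ge0.
Qed.

(** Telescope [lyapunov_stS] and drop the nonnegative final value; the initial state is
    deterministic, so its Lyapunov value is explicit. *)
Let sum_gap_le k :
  gamma * \sum_(0 <= j < k) \int[P]_w gap (Xk j w) <=
  sqnorm (x0 - xstar) + c * \sum_(i < n) omega i * sqnorm (h0 i - s i xstar).
Proof.
have V0 : lyapunov P (Xk 0) (Hk 0) =
    sqnorm (x0 - xstar) + c * \sum_(i < n) omega i * sqnorm (h0 i - s i xstar).
  have Ecst (a : R) : \int[P]_w a = a.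
    by rewrite Rintegral_cst// [X in fine X](_ : _ = 1%E) ?mulr1//; exact: probability_setT.
  rewrite /lyapunov; congr (_ + _ * _); first exact: (Ecst (sqnorm (x0 - xstar))).
  by apply: eq_bigr => i _; congr (_ * _); exact: (Ecst (sqnorm (h0 i - s i xstar))).
rewrite -V0.
suff : lyapunov P (Xk k) (Hk k) + gamma * \sum_(0 <= j < k) \int[P]_w gap (Xk j w) <=
       lyapunov P (Xk 0) (Hk 0).
  by apply: le_trans; rewrite lerDr lyapunov_ge0.
elim: k => [|k ih]; first by rewrite big_nil mulr0 addr0.
rewrite big_nat_recr//= mulrDr; have := lyapunov_stS k; lra.
Qed.

Lemma expected_gap_mean_le k : (0 < k)%N ->
  (\int[P]_w (gap (k%:R^-1 *: \sum_(1 <= j < k.+1) Xk j w))%:E <=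
   ((gamma^-1 * (sqnorm (x0 - xstar)
     + c * \sum_(i < n) omega i * sqnorm (h0 i - s i xstar))) / k%:R)%:E)%E.
Proof.
move=> k0; have sX j := (sqint_st j).1.
have k_gt0 : 0 < k%:R :> R by rewrite ltr0n.
have sz : size (index_iota 1 k.+1) = k by rewrite size_iota subn1.
have sbar : sqint P (fun w => k%:R^-1 *: \sum_(1 <= j < k.+1) Xk j w).
  by apply: sqintZ; exact: sqint_sum.
have igap j := rintegrable_gap (sX j).
have isum : rintegrable P (fun w => \sum_(1 <= j < k.+1) gap (Xk j w)).
  exact: rintegrable_sum.
have imean := rintegrableZ k%:R^-1 isum.
have -> : (\int[P]_w (gap (k%:R^-1 *: \sum_(1 <= j < k.+1) Xk j w))%:E =
    (\int[P]_w gap (k%:R^-1 *: \sum_(1 <= j < k.+1) Xk j w))%R%:E)%E.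
  by rewrite /Rintegral fineK//; apply: integrable_fin_num => //; exact: rintegrable_gap.
rewrite lee_fin.
apply: (@le_trans _ _ (k%:R^-1 * \sum_(1 <= j < k.+1) \int[P]_w gap (Xk j w))).
  rewrite -Rintegral_sum// -expectZ//; apply: le_Rintegral => //.
    exact: rintegrable_gap.
  by move=> w _; rewrite -[in X in X^-1 *: _]sz -[in X in X^-1 * _]sz avg_fun_mean// sz.
rewrite [leRHS]mulrC ler_wpM2l ?invr_ge0 ?ler0n//.
(* The mean runs over iterates 1 to [k], so the telescoped bound is taken over [k.+1] rounds and its
   nonnegative term at 0 is discarded. *)
rewrite ler_pdivlMl//; apply: le_trans (sum_gap_le k.+1).
rewrite ler_pM2l// [leRHS]big_ltn// lerDr.
by apply: Rintegral_ge0 => w _; exact: gap_ge0.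
Qed.

End rate.

End descent.

(** * Specialization to the personalized objective *)

Theorem theorem6
  (R : realType) (d n : nat) (n_gt0 : (0 < n)%N)
  (f : 'I_n -> 'rV[R]_d -> R) (gf : 'I_n -> 'rV[R]_d -> 'rV[R]_d)
  (L : 'I_n -> R) (xs : 'I_n -> 'rV[R]_d)
  (alpha omega beta : 'I_n -> R)
  (f_convex : forall i, convex_fun (f i))
  (gf_grad : forall i, is_gradient (f i) (gf i))
  (f_smooth : forall i, L_smooth (gf i) (L i))
  (L_ge0 : forall i, 0 <= L i)
  (xs_min : forall i, is_minimizer (f i) (xs i))
  (alpha_range : forall i, 0 < alpha i < 1)
  (omega_ge0 : forall i, 0 <= omega i)
  (beta_range : forall i, 0 < beta i <= (omega i + 1)^-1)
  (xstar : 'rV[R]_d)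
  (* probability space and the random compressors C_i^k(w) = Phi k i (xi k i w) *)
  (dO : measure_display) (Omega : measurableType dO) (P : probability Omega R)
  (dX : measure_display) (X : measurableType dX)
  (xi : nat -> 'I_n -> Omega -> X) (Phi : nat -> 'I_n -> X -> 'rV[R]_d -> 'rV[R]_d)
  (xi_meas : forall k i, measurable_fun [set: Omega] (xi k i))
  (Phi_meas : forall k i, jointly_measurable (Phi k i))
  (xi_indep : mutually_independent P (fun p : nat * 'I_n => xi p.1 p.2))
  (C_in_B : forall k i, in_Bd P (fun w => Phi k i (xi k i w)) (omega i))
  (x0 : 'rV[R]_d) (h0 : 'I_n -> 'rV[R]_d) (gamma : R) :
  let T := fun i (x : 'rV[R]_d) => alpha i *: x + (1 - alpha i) *: xs i in
  let ft := fun x : 'rV[R]_d => n%:R^-1 * \sum_(i < n) f i (T i x) in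
  let L_alpha := n%:R^-1 * \sum_(i < n) alpha i ^+ 2 * L i in
  let max1 := \big[Num.max/0]_(i < n) (L i * alpha i ^+ 2 * omega i) in
  let max2 := \big[Num.max/0]_(i < n) (beta i * omega i * L i * alpha i ^+ 2) in
  let minb := \big[Num.min/1]_(i < n) beta i in
  let sigma0 := n%:R^-1 * \sum_(i < n)
       omega i * sqnorm (h0 i - alpha i *: gf i (T i xstar)) in
  let iter := fun k (w : Omega) =>
       (diana alpha beta gamma T gf x0 h0 (fun k i => Phi k i (xi k i w)) k).1 in
  let xbar := fun k w => k%:R^-1 *: \sum_(1 <= j < k.+1) iter j w in
  is_minimizer ft xstar ->
  0 < gamma ->
  gamma <= (4 * (L_alpha + 2 * max1 / n%:R + 4 * max2 / (n%:R * minb)))^-1 ->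
  forall k : nat, (0 < k)%N ->
  (\int[P]_w (ft (xbar k w) - ft xstar)%:E <=
   ((2 * (ft x0 - ft xstar) + 4 * gamma / (n%:R * minb) * sigma0
     + gamma^-1 * sqnorm (x0 - xstar)) / k%:R)%:E)%E.
Proof.
move=> T ft L_alpha max1 max2 minb sigma0 iter xbar xstar_min gamma_gt0 gamma_le k k_gt0.
pose s i x := alpha i *: gf i (T i x).
pose phi i x := f i (T i x).
pose ell i := alpha i ^+ 2 * L i.
have a_ge0 i : 0 <= alpha i by have /andP[/ltW] := alpha_range i.
have N_gt0 : 0 < n%:R :> R by rewrite ltr0n.
have TB i x y : T i y - T i x = alpha i *: (y - x).
  by apply/rowP => j; rewrite !mxE; ring.
have ell_ge0 i : 0 <= ell i by rewrite mulr_ge0 ?sqr_ge0.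
have phi_le i x y :
    phi i y <= phi i x + dotv (s i x) (y - x) + ell i / 2 * sqnorm (y - x).
  have := taylor1_upper (gf_grad i) (f_smooth i) (T i x) (T i y).
  by rewrite TB dotvZr sqnormZ dotvZl /phi /ell; lra.
have phi_ge i x y : phi i x + dotv (s i x) (y - x) <= phi i y.
  have := convex_ge_tangent (gf_grad i) (f_smooth i) (f_convex i) (T i x) (T i y).
  by rewrite TB dotvZr dotvZl.
have b_gt0 : 0 < minb.
  (* The default value 1 of the minimum is positive, as is every [beta i]. *)
  by apply/bigmin_gtP; split=> // i _; have /andP[] := beta_range i.
have b_le i : minb <= beta i by exact: bigmin_le.
have m1_ge i : omega i * ell i <= max1.
  have -> : omega i * ell i = L i * alpha i ^+ 2 * omega i by rewrite /ell; ring.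
  exact: (le_bigmax 0 (fun i => L i * alpha i ^+ 2 * omega i)).
have m2_ge i : beta i * omega i * ell i <= max2.
  have -> : beta i * omega i * ell i = beta i * omega i * L i * alpha i ^+ 2.
    by rewrite /ell; ring.
  exact: (le_bigmax 0 (fun i => beta i * omega i * L i * alpha i ^+ 2)).
have gamma_le' : gamma * (L_alpha + 2 * max1 / n%:R + 4 * max2 / (n%:R * minb)) <= 4^-1.
  have := gamma_le; set K := L_alpha + _ + _.
  (* As [0 < gamma <= (4 * K)^-1], the inverse is positive and so is [4 * K]; this excludes [K = 0],
     whose inverse would be 0. *)
  move=> gK; have K_gt0 : 0 < 4 * K by rewrite -invr_gt0 (lt_le_trans gamma_gt0).
  have := ler_wpM2r (ltW K_gt0) gK; rewrite mulVf ?gt_eqF//; lra.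
have s_smooth i : L_smooth (s i) (ell i).
  move=> x y; rewrite /s -scalerBr enormZ ger0_norm//.
  have := f_smooth i (T i x) (T i y); rewrite TB enormZ ger0_norm// => h.
  by have := ler_wpM2l (a_ge0 i) h; rewrite /ell; lra.
have T_cont i : continuous (T i).
  apply: (L_smooth_continuous (a_ge0 i)) => x y.
  by rewrite TB enormZ ger0_norm.
have phi_cont i : continuous (phi i).
  move=> x; apply: (@continuous_comp _ _ _ (T i) (f i)); first exact: T_cont.
  by apply: differentiable_continuous; exact: (gf_grad i (T i x)).1.
have rate := expected_gap_mean_le n_gt0 ell_ge0 phi_le phi_ge omega_ge0 beta_range b_gt0
  b_le m1_ge m2_ge gamma_gt0 gamma_le' xstar_min phi_cont s_smooth (fun i x => erefl)
  Phi_meas x0 h0 xi_meas xi_indep C_in_B k_gt0.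
apply: (le_trans rate); rewrite lee_fin ler_pM2r ?invr_gt0 ?ltr0n//.
have -> : 4 * gamma / (n%:R * minb) * sigma0 = gamma^-1 * (@lyapunov_weight R n gamma minb *
    \sum_(i < n) omega i * sqnorm (h0 i - s i xstar)).
  by rewrite /lyapunov_weight /sigma0; field; rewrite !gt_eqF.
(* What remains is [2 * (ft x0 - ft xstar)], nonnegative by minimality. *)
have := xstar_min x0; lra.
Qed.
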